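(* There exist theories $T_I$ (with sort INDEX) and $T_E$ (with sort ELEM), where $T_I$ is locally finite and closed under substructures, $T_E$ is locally finite, and the satisfiability of quantifier-free formulae modulo $T_I$ and modulo $T_E$ is decidable, and there exists an array-based system $\mathcal S=(a,I,\tau)$ for $(T_I,T_E)$, such that the following problem is undecidable: given an $\exists^I$-formula $U(a)$, decide whether $\mathcal S$ is safe with respect to $U$.
   Context: A theory $T=(\Sigma,\mathcal C)$ is a signature with a class of $\Sigma$-structures (its models); $T$-satisfiable means true in some model of $T$ under some assignment, $T$-valid ($T\models\varphi$) means true in all models under all assignments, and $T$-equivalent formulae are those whose biconditional is $T$-valid. $T$ is locally finite if $\Sigma$ is finite and for every finite tuple of variables $\underline x$ there are finitely many $\Sigma(\underline x)$-terms, effectively computable from $\underline x$, such that every $\Sigma(\underline x)$-term $u$ satisfies $T\models u=t$ for one of them (computable from $u$). $T$ is closed under substructures if every substructure of a model of $T$ is a model of $T$. Given $T_I=(\Sigma_I,\mathcal C_I)$ (sort INDEX) and $T_E=(\Sigma_E,\mathcal C_E)$ (sort ELEM), the theory $A_I^E$ has sorts INDEX, ELEM, ARRAY, signature $\Sigma_I\cup\Sigma_E\cup\{\_[\_]\}$ with $\_[\_]$ of type ARRAY$\times$INDEX$\to$ELEM, and its models are the three-sorted structures whose INDEX-part is a model of $T_I$, whose ELEM-part is a model of $T_E$, where ARRAY is the set of all total functions from INDEX to ELEM and $a[i]$ is function application. $a,a'$ denote ARRAY variables, $\underline i$ tuples of INDEX variables; $\phi(\underline i,\underline e)$ denotes a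 quantifier-free $(\Sigma_I\cup\Sigma_E)$-formula and $\phi(\underline i,a[\underline i])$ the result of substituting $a[\underline i]$ for the ELEM variables $\underline e$. An $\exists^I$-formula has the form $\exists\underline i\,\phi(\underline i,a[\underline i])$, a $\forall^I$-formula the form $\forall\underline i\,\phi(\underline i,a[\underline i])$. A case-defined function is a fresh function symbol $F$ given by a $T$-partition $C_1(\underline x),\dots,C_n(\underline x)$ (quantifier-free formulae which are jointly exhaustive and pairwise exclusive modulo the theory) and terms $t_1,\dots,t_n$, with $F(\underline x)=t_k(\underline x)$ whenever $C_k(\underline x)$ holds. An array-based system for $(T_I,T_E)$ is a triple $\mathcal S=(a,I,\tau)$ where $I(a)$ is a $\forall^I$-formula and $\tau(a,a')$ is a finite disjunction of formulae $\exists\underline i\,(\phi_L(\underline i,a[\underline i])\wedge\forall j\,a'[j]=F_G(\underline i,a[\underline i],j,a[j]))$ with $\phi_L$ quantifier-free and $F_G$ a case-defined function. $\mathcal S$ is unsafe with respect to an $\exists^I$-formula $U$ if for some $n\ge0$ the formula $I(a_0)\wedge\tau(a_0,a_1)\wedge\dots\wedge\tau(a_{n-1},a_n)\wedge U(a_n)$ is $A_I^E$-satisfiable; otherwise it is safe. *)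

(* Defs.v *)
From Stdlib Require List.
From mathcomp Require Import all_boot.

Set Implicit Arguments.
Unset Strict Implicit.
Unset Printing Implicit Defensive.

(* Computability: Kleene's partial recursive functions. Arguments are lists;
   missing arguments read as 0 and superfluous ones are ignored. *)

Inductive recfun : Type :=
| RZero
| RSucc
| RProj of nat
| RComp of recfun & seq recfun
| RRec of recfun & recfun
| RMin of recfun.

(* [reval c xs y]: the partial function [c] is defined at [xs], with value [y].
   [RRec f g] is h(0, xs) = f(xs), h(k+1, xs) = g(k, h(k, xs), xs);
   [RMin f] at [xs] is the least y such that f(y, xs) = 0, all the f(k, xs) with
   k < y being defined (and nonzero). *)
Fixpoint reval (c : recfun) (xs : seq nat) (y : nat) {struct c} : Prop :=
  match c with
  | RZero => y = 0
  | RSucc => y = (head 0 xs).+1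
  | RProj i => y = nth 0 xs i
  | RComp f gs =>
      exists2 ys : seq nat,
        (fix revals (gs : seq recfun) (ys : seq nat) : Prop :=
           match gs, ys with
           | [::], [::] => True
           | g :: gs', y' :: ys' => reval g xs y' /\ revals gs' ys'
           | _, _ => False
           end) gs ys
        & reval f ys y
  | RRec f g =>
      exists h : nat -> nat,
        [/\ reval f (behead xs) (h 0),
            forall k, k < head 0 xs -> reval g [:: k, h k & behead xs] (h k.+1)
          & y = h (head 0 xs)]
  | RMin f =>
      reval f (y :: xs) 0
      /\ (forall k, k < y -> exists z, reval f (k :: xs) z.+1)
  end.

(* Decidability of a problem whose instances [x] are presented by [code x]. *)
Definition rec_decidable (X : Type) (code : X -> nat) (P : X -> Prop) : Prop :=
  exists c : recfun, forall x : X,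
    (P x -> reval c [:: code x] 1) /\ (~ P x -> reval c [:: code x] 0).

(* Countability of the symbol sets only serves to Goedel-number the syntax. *)
Record signature : Type := Signature {
  fsym : countType;
  farity : fsym -> nat;
  psym : countType;
  parity : psym -> nat
}.

Definition finite_signature (Sg : signature) : Prop :=
  (exists s : seq (fsym Sg), forall f, f \in s)
  /\ (exists s : seq (psym Sg), forall p, p \in s).

(* [term Sg V]: the terms with variables in [V]; [term Sg 'I_n] is the type of
   Sg(x)-terms for a tuple x of n variables. *)
Inductive term (Sg : signature) (V : Type) : Type :=
| Var of V
| Fn (f : fsym Sg) of ('I_(farity f) -> term Sg V).
Arguments Var {Sg V}.
Arguments Fn {Sg V}.

Inductive atom (Sg : signature) (V : Type) : Type :=
| AEq of term Sg V & term Sg V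
| APred (p : psym Sg) of ('I_(parity p) -> term Sg V).
Arguments AEq {Sg V}.
Arguments APred {Sg V}.

Inductive qform (A : Type) : Type :=
| QAtom of A
| QFalse
| QNot of qform A
| QAnd of qform A & qform A
| QOr of qform A & qform A.
Arguments QFalse {A}.

(* Quantifier-free formulae over Sg, and over the (disjoint) union of a
   signature of sort INDEX and a signature of sort ELEM. *)
Definition qf (Sg : signature) (V : Type) : Type := qform (atom Sg V).
Definition qf2 (SI SE : signature) (VI VE : Type) : Type :=
  qform (atom SI VI + atom SE VE).

Record structure (Sg : signature) : Type := Structure {
  carrier :> Type;
  carrier_inhabited : inhabited carrier;
  fint : forall f : fsym Sg, ('I_(farity f) -> carrier) -> carrier;
  pint : forall p : psym Sg, ('I_(parity p) -> carrier) -> Prop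
}.

Section Semantics.
Variables (Sg : signature) (M : structure Sg) (V : Type) (v : V -> M).

Fixpoint teval (t : term Sg V) : M :=
  match t with
  | Var x => v x
  | Fn f ts => fint (fun k => teval (ts k))
  end.

Definition atom_holds (a : atom Sg V) : Prop :=
  match a with
  | AEq t u => teval t = teval u
  | APred p ts => pint (fun k => teval (ts k))
  end.

End Semantics.

Fixpoint qholds (A : Type) (h : A -> Prop) (phi : qform A) : Prop :=
  match phi with
  | QAtom a => h a
  | QFalse => False
  | QNot p => ~ qholds h p
  | QAnd p q => qholds h p /\ qholds h q
  | QOr p q => qholds h p \/ qholds h q
  end.

Definition qf_holds (Sg : signature) (M : structure Sg) (V : Type) (v : V -> M)
    (phi : qf Sg V) : Prop :=
  qholds (atom_holds v) phi.

Definition qf2_holds (SI SE : signature) (MI : structure SI) (ME : structure SE)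
    (VI VE : Type) (vI : VI -> MI) (vE : VE -> ME) (phi : qf2 SI SE VI VE) : Prop :=
  qholds (fun a => match a with
                   | inl b => atom_holds vI b
                   | inr b => atom_holds vE b
                   end) phi.

Section Coding.
Variable Sg : signature.

Fixpoint code_term (V : Type) (cV : V -> nat) (t : term Sg V) : nat :=
  match t with
  | Var x => CodeSeq.code [:: 0; cV x]
  | Fn f ts =>
      CodeSeq.code [:: 1, pickle f &
                    [seq code_term cV (ts k) | k <- enum 'I_(farity f)]]
  end.

Definition code_atom (V : Type) (cV : V -> nat) (a : atom Sg V) : nat :=
  match a with
  | AEq t u => CodeSeq.code [:: 0; code_term cV t; code_term cV u]
  | APred p ts =>
      CodeSeq.code [:: 1, pickle p &
                    [seq code_term cV (ts k) | k <- enum 'I_(parity p)]]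
  end.

End Coding.

Fixpoint code_qform (A : Type) (cA : A -> nat) (phi : qform A) : nat :=
  match phi with
  | QAtom a => CodeSeq.code [:: 0; cA a]
  | QFalse => CodeSeq.code [:: 1]
  | QNot p => CodeSeq.code [:: 2; code_qform cA p]
  | QAnd p q => CodeSeq.code [:: 3; code_qform cA p; code_qform cA q]
  | QOr p q => CodeSeq.code [:: 4; code_qform cA p; code_qform cA q]
  end.

Definition code_qf (Sg : signature) (phi : qf Sg nat) : nat :=
  code_qform (code_atom id) phi.

Definition code_qf2 (SI SE : signature) (n : nat) (phi : qf2 SI SE 'I_n 'I_n) : nat :=
  code_qform (fun a => match a with
                       | inl b => CodeSeq.code [:: 0; code_atom val b]
                       | inr b => CodeSeq.code [:: 1; code_atom val b]
                       end) phi.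

Record theory : Type := Theory {
  sig_of :> signature;
  models : structure sig_of -> Prop
}.

Definition valid_eq (T : theory) (V : Type) (t u : term T V) : Prop :=
  forall M : structure T, models M -> forall v : V -> M, teval v t = teval v u.

Definition qf_satisfiable (T : theory) (phi : qf T nat) : Prop :=
  exists (M : structure T) (v : nat -> M), models M /\ qf_holds v phi.

Definition qf_sat_decidable (T : theory) : Prop :=
  rec_decidable (@code_qf T) (@qf_satisfiable T).

(* [rep n] is the finite list of representative terms in n variables, and
   [nf n u] the one that is T-equal to [u]. *)
Definition locally_finite (T : theory) : Prop :=
  finite_signature T /\
  exists (rep : forall n : nat, seq (term T 'I_n))
         (nf : forall n : nat, term T 'I_n -> term T 'I_n),
    [/\ exists c : recfun, forall n,
          reval c [:: n] (CodeSeq.code [seq code_term val t | t <- rep n]),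
        exists c : recfun, forall n (u : term T 'I_n),
          reval c [:: n; code_term val u] (code_term val (nf n u))
      & forall n (u : term T 'I_n), List.In (nf n u) (rep n) /\ valid_eq u (nf n u)].

(* Carriers being types, N is a substructure of M through an inclusion map. *)
Definition substructure (Sg : signature) (N M : structure Sg) : Prop :=
  exists h : N -> M,
    [/\ injective h,
        forall (f : fsym Sg) (xs : 'I_(farity f) -> N),
          h (fint xs) = fint (fun k => h (xs k))
      & forall (p : psym Sg) (xs : 'I_(parity p) -> N),
          pint xs <-> pint (fun k => h (xs k))].

Definition closed_under_substructures (T : theory) : Prop :=
  forall N M : structure T, models M -> substructure N M -> models N.

(* The models of A_I^E. The sort ARRAY is interpreted by the full function
   type, and a[i] by application. *)
Record array_model (TI TE : theory) : Type := ArrayModel {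
  index_part : structure TI;
  elem_part : structure TE;
  index_model : models index_part;
  elem_model : models elem_part
}.

Definition array (TI TE : theory) (M : array_model TI TE) : Type :=
  index_part M -> elem_part M.

(* phi(i, e), to be prefixed by "exists i" or "forall i" after substitution of
   a[i] for e: the INDEX variable i_k and the ELEM variable e_k are both
   represented by k : 'I_n. *)
Record existsI_formula (SI SE : signature) : Type := ExistsI {
  ex_n : nat;
  ex_matrix : qf2 SI SE 'I_ex_n 'I_ex_n
}.

Record forallI_formula (SI SE : signature) : Type := ForallI {
  all_n : nat;
  all_matrix : qf2 SI SE 'I_all_n 'I_all_n
}.

Definition code_existsI (SI SE : signature) (U : existsI_formula SI SE) : nat :=
  CodeSeq.code [:: ex_n U; code_qf2 (ex_matrix U)].

Section ArraySystems.
Variables TI TE : theory.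

(* phi(i, a[i]) *)
Definition holds_at (M : array_model TI TE) (n : nat) (phi : qf2 TI TE 'I_n 'I_n)
    (i : 'I_n -> index_part M) (a : array M) : Prop :=
  qf2_holds i (fun k => a (i k)) phi.

Definition existsI_holds (M : array_model TI TE) (U : existsI_formula TI TE)
    (a : array M) : Prop :=
  exists i : 'I_(ex_n U) -> index_part M, holds_at (ex_matrix U) i a.

Definition forallI_holds (M : array_model TI TE) (I : forallI_formula TI TE)
    (a : array M) : Prop :=
  forall i : 'I_(all_n I) -> index_part M, holds_at (all_matrix I) i a.

(* Quantifier-free formulae and ELEM terms in the arguments (i, e, j, d) of F_G:
   [Some k] stands for i_k (resp. e_k), [None] for j (resp. d). *)
Definition guard (n : nat) : Type := qf2 TI TE (option 'I_n) (option 'I_n).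
Definition update (n : nat) : Type := term TE (option 'I_n).

Definition extend (n : nat) (X : Type) (xs : 'I_n -> X) (x : X) : option 'I_n -> X :=
  oapp xs x.

Definition guard_holds (M : array_model TI TE) (n : nat) (C : guard n)
    (i : 'I_n -> index_part M) (e : 'I_n -> elem_part M)
    (j : index_part M) (d : elem_part M) : Prop :=
  qf2_holds (extend i j) (extend e d) C.

Definition partition_mod (n m : nat) (C : 'I_m -> guard n) : Prop :=
  forall (M : array_model TI TE) (i : 'I_n -> index_part M)
         (e : 'I_n -> elem_part M) (j : index_part M) (d : elem_part M),
    (exists k, guard_holds (C k) i e j d)
    /\ (forall k l, k <> l ->
          ~ (guard_holds (C k) i e j d /\ guard_holds (C l) i e j d)).

Record case_defined (n : nat) : Type := CaseDefined {
  case_nb : nat;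
  case_guard : 'I_case_nb -> guard n;
  case_term : 'I_case_nb -> update n;
  case_partition : partition_mod case_guard
}.

(* An interpretation [F] of the fresh symbol F_G that satisfies its definition. *)
Definition interprets_case (M : array_model TI TE) (n : nat) (G : case_defined n)
    (F : ('I_n -> index_part M) -> ('I_n -> elem_part M) ->
         index_part M -> elem_part M -> elem_part M) : Prop :=
  forall i e j d (k : 'I_(case_nb G)),
    guard_holds (case_guard k) i e j d ->
    F i e j d = teval (extend e d) (case_term k).

(* exists i, phi_L(i, a[i]) /\ forall j, a'[j] = F_G(i, a[i], j, a[j]) *)
Record transition : Type := Transition {
  tr_n : nat;
  tr_guard : qf2 TI TE 'I_tr_n 'I_tr_n;
  tr_update : case_defined tr_n
}.

Record array_system : Type := ArraySystem {
  sys_init : forallI_formula TI TE;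
  sys_nb : nat;
  sys_tr : 'I_sys_nb -> transition
}.

Section Safety.
Variable S : array_system.

(* Interpretations in M of the fresh symbols F_G of the system. *)
Definition case_functions (M : array_model TI TE) : Type :=
  forall r : 'I_(sys_nb S),
    ('I_(tr_n (sys_tr r)) -> index_part M) ->
    ('I_(tr_n (sys_tr r)) -> elem_part M) ->
    index_part M -> elem_part M -> elem_part M.

Definition step_holds (M : array_model TI TE) (F : case_functions M)
    (a a' : array M) : Prop :=
  exists (r : 'I_(sys_nb S)) (i : 'I_(tr_n (sys_tr r)) -> index_part M),
    holds_at (tr_guard (sys_tr r)) i a
    /\ (forall j, a' j = F r i (fun k => a (i k)) j (a j)).

(* Satisfiability of I(a_0) /\ tau(a_0, a_1) /\ .. /\ tau(a_(n-1), a_n) /\ U(a_n)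
   in a model of A_I^E expanded with the case-defined functions; only the values
   a_0, .., a_n of the assignment [a] matter. *)
Definition unsafe (U : existsI_formula TI TE) : Prop :=
  exists (n : nat) (M : array_model TI TE) (F : case_functions M)
         (a : nat -> array M),
    [/\ forall r, interprets_case (tr_update (sys_tr r)) (F r),
        forallI_holds (sys_init S) (a 0),
        forall m, m < n -> step_holds F (a m) (a m.+1)
      & existsI_holds U (a n)].

Definition safe (U : existsI_formula TI TE) : Prop := ~ unsafe U.

End Safety.
End ArraySystems.

(* Main.v *)
(* Both theories are the theory of all structures over a purely relational
   signature: terms are variables, so local finiteness and closure under
   substructures are immediate, and a satisfiable quantifier-free formula has a model
   bounded in terms of its code. The relations are read as records, and the initial
   formula makes the record of a node unique. An index structure can then contain
   numbers, lists, the syntax trees of recursive functions, and nodes that state "the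
   program p maps the list l to y". The transitions are the Horn rules of the
   evaluation relation: they mark such a node as soon as the nodes of its premises are
   marked. Marking takes as many steps as the evaluation needs derivation nodes, which
   is why no bound on the length of a run is available.

   A formula U can spell out a program c, a number k in unary, and the requirement
   that the node "c maps [k] to 1" is marked; the system is unsafe for U iff c does map
   [k] to 1. No enumeration of programs is needed: a program is represented by its own
   description in U, and k is taken to be the code of that description. The code of U
   is then a computable function d of k, and if c0 decided safety, the program
   c := c0 o d, applied to the code of its own description, would be contradictory. *)

Require Import Defs.
From Stdlib Require Import FunctionalExtensionality ClassicalEpsilon.
From mathcomp Require Import all_boot zify.

Set Implicit Arguments.
Unset Strict Implicit.
Unset Printing Implicit Defensive.

Local Arguments CodeSeq.code : simpl never.

(** * Partial recursive functions *)

(** Names the local fixpoint in the [RComp] case of [reval], to which it is convertible. *)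
Definition revals (xs : seq nat) :=
  fix revals (gs : seq recfun) (ys : seq nat) : Prop :=
    match gs, ys with
    | [::], [::] => True
    | g :: gs', y :: ys' => reval g xs y /\ revals gs' ys'
    | _, _ => False
    end.

(** The type [recfun] is nested through [seq]; the predicate [Q] carries the induction through the
    argument lists of [RComp]. *)
Lemma recfun_seq_ind (P : recfun -> Prop) (Q : seq recfun -> Prop) :
  P RZero -> P RSucc -> (forall i, P (RProj i)) ->
  (forall f gs, P f -> Q gs -> P (RComp f gs)) ->
  (forall f g, P f -> P g -> P (RRec f g)) ->
  (forall f, P f -> P (RMin f)) ->
  Q [::] -> (forall g gs, P g -> Q gs -> Q (g :: gs)) ->
  forall c, P c.
Proof.
move=> P0 PS Pi PC PR PM Q0 QS.
fix IH 1; case=> [| |i|f gs|f g|f].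
- exact: P0.
- exact: PS.
- exact: Pi.
- by apply: (PC f gs (IH f)); elim: gs => [|g gs]; [apply: Q0 | apply: QS; apply: IH].
- exact: PR (IH f) (IH g).
- exact: PM (IH f).
Qed.

(** Two histories of a recursion agree by induction on the index; of two distinct minima, the
    smaller would be a point where the function is both zero and nonzero. *)
Lemma reval_inj c xs y z : reval c xs y -> reval c xs z -> y = z.
Proof.
move: c xs y z; apply: (@recfun_seq_ind _
    (fun gs => forall xs ys zs, revals xs gs ys -> revals xs gs zs -> ys = zs)).
- by move=> xs y z /= -> ->.
- by move=> xs y z /= -> ->.
- by move=> i xs y z /= -> ->.
- move=> f gs IHf IHgs xs y z [ys gys fy] [zs gzs fz].
  by move: fz; rewrite -(IHgs _ _ _ gys gzs); apply: IHf.
- move=> f g IHf IHg xs y z /= [h [h0 hS ->]] [h' [h'0 h'S ->]].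
  elim: (head 0 xs) hS h'S => [|n IHn] hS h'S; first exact: IHf h0 h'0.
  have Eh : h n = h' n.
    by apply: IHn => k lt_kn; [apply: hS | apply: h'S]; apply: ltnW.
  by move: (h'S n (ltnSn n)); rewrite -Eh; apply: IHg; apply: hS.
- move=> f IHf xs y z /= [fy yP] [fz zP].
  have [lt_yz|lt_zy|//] := ltngtP y z.
  + by have [u fu] := zP y lt_yz; have := IHf _ _ _ fy fu.
  + by have [u fu] := yP z lt_zy; have := IHf _ _ _ fz fu.
- by move=> xs [|y ys] [|z zs].
- move=> g gs IHg IHgs xs [|y ys] [|z zs] //= [gy gys] [gz gzs].
  by rewrite (IHg _ _ _ gy gz) (IHgs _ _ _ gys gzs).
Qed.

(** * Closure properties of computable functions *)

Definition computable (m : nat) (f : seq nat -> nat) : Prop :=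
  exists c, forall xs, size xs = m -> reval c xs (f xs).

Lemma eq_computable m f g :
  (forall xs, f xs = g xs) -> computable m f -> computable m g.
Proof. by move=> fg [c cP]; exists c => xs xsm; rewrite -fg; apply: cP. Qed.

Lemma computable_nth m i : computable m (fun xs => nth 0 xs i).
Proof. by exists (RProj i). Qed.

Lemma computable_nth_drop m j i : computable m (fun xs => nth 0 (drop j xs) i).
Proof. by exists (RProj (j + i)) => xs _ /=; rewrite nth_drop. Qed.

Lemma computable_comp k m f (gs : seq (seq nat -> nat)) :
  computable k f -> size gs = k ->
  (forall g, List.In g gs -> computable m g) ->
  computable m (fun xs => f [seq g xs | g <- gs]).
Proof.
move=> [c cP] gsk gsP.
suff [ds dsP] : exists ds, forall xs, size xs = m ->
    revals xs ds [seq g xs | g <- gs].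
  exists (RComp c ds) => xs xsm; exists [seq g xs | g <- gs]; first exact: dsP.
  by apply: cP; rewrite size_map.
elim: gs {gsk} gsP => [|g gs IH] gsP; first by exists [::].
have [d dP] := gsP g (or_introl erefl).
have [ds dsP] := IH (fun h hgs => gsP h (or_intror hgs)).
by exists (d :: ds) => xs xsm /=; split; [apply: dP | apply: dsP].
Qed.

Lemma computable_app1 m (F : nat -> nat) f :
  computable 1 (fun xs => F (nth 0 xs 0)) ->
  computable m f -> computable m (fun xs => F (f xs)).
Proof.
move=> FP fP; apply: (computable_comp (gs := [:: f]) FP) => // g.
by case=> [<-|[]].
Qed.

Lemma computable_app2 m (F : nat -> nat -> nat) f g :
  computable 2 (fun xs => F (nth 0 xs 0) (nth 0 xs 1)) ->
  computable m f -> computable m g -> computable m (fun xs => F (f xs) (g xs)).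
Proof.
move=> FP fP gP; apply: (computable_comp (gs := [:: f; g]) FP) => // h.
by case=> [<-|[<-|[]]].
Qed.

Lemma computable_app4 m (F : nat -> nat -> nat -> nat -> nat) f g h k :
  computable 4 (fun xs => F (nth 0 xs 0) (nth 0 xs 1) (nth 0 xs 2) (nth 0 xs 3)) ->
  computable m f -> computable m g -> computable m h -> computable m k ->
  computable m (fun xs => F (f xs) (g xs) (h xs) (k xs)).
Proof.
move=> FP fP gP hP kP.
apply: (computable_comp (gs := [:: f; g; h; k]) FP) => // l.
by case=> [<-|[<-|[<-|[<-|[]]]]].
Qed.

Lemma computable_succ m f : computable m f -> computable m (fun xs => (f xs).+1).
Proof. by apply: computable_app1; exists RSucc => -[|x []]. Qed.

Lemma computable_const m n : computable m (fun=> n).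
Proof.
elim: n => [|n IH]; first by exists RZero.
exact: computable_succ IH.
Qed.

(** Primitive recursion with parameters: in [ys], position 0 is the counter, position 1 the
    accumulated value, and [drop 2 ys] the parameters. Arithmetic and bounded search reduce to
    it. *)
Lemma computable_iteri m n f g :
  computable m n -> computable m f ->
  computable m.+2 (fun ys => g (nth 0 ys 0) (nth 0 ys 1) (drop 2 ys)) ->
  computable m (fun xs => iteri (n xs) (fun k y => g k y xs) (f xs)).
Proof.
move=> nP [cf cfP] [cg cgP].
have recP : computable m.+1 (fun ys =>
    iteri (head 0 ys) (fun k y => g k y (behead ys)) (f (behead ys))).
  exists (RRec cf cg) => -[|x xs] //= [xsm].
  exists (fun j => iteri j (fun k y => g k y xs) (f xs)); split=> //= [|k _].
    exact: cfP.
  have /= := cgP [:: k, iteri k (fun k y => g k y xs) (f xs) & xs].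
  by rewrite drop0; apply; rewrite xsm.
(* Composing with all projections rebuilds the parameter list as [mkseq (nth 0 xs) m], which is [xs]
   when its size is [m]. *)
have projP : computable m (fun xs =>
    iteri (n xs) (fun k y => g k y (mkseq (nth 0 xs) m)) (f (mkseq (nth 0 xs) m))).
  have /= := computable_comp
    (gs := n :: [seq (fun xs => nth 0 xs i) | i <- iota 0 m]) (m := m) recP.
  rewrite size_map size_iota => /(_ erefl) H.
  apply: eq_computable (H _) => [xs|h]; first by rewrite -map_comp.
  case=> [<-//|]; elim: (iota 0 m) => //= i s IH [<-|//].
  exact: computable_nth.
have [c cP] := projP; exists c => xs xsm.
by have := cP xs xsm; rewrite -[in mkseq _ _]xsm mkseq_nth.
Qed.

Lemma computable_add m f g :
  computable m f -> computable m g -> computable m (fun xs => f xs + g xs).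
Proof.
apply: computable_app2.
apply: (@eq_computable _ (fun xs =>
  iteri (nth 0 xs 0) (fun _ y => y.+1) (nth 0 xs 1))) => [xs|].
  by elim: (nth 0 xs 0) => //= n ->.
apply: (@computable_iteri 2 _ _ (fun _ y _ => y.+1)); try exact: computable_nth.
by apply: computable_succ; apply: computable_nth.
Qed.

Lemma computable_sum m n F :
  computable m n -> computable m.+2 (fun ys => F (nth 0 ys 0) (drop 2 ys)) ->
  computable m (fun xs => \sum_(i < n xs) F i xs).
Proof.
move=> nP FP.
apply: (@eq_computable _ (fun xs =>
    iteri (n xs) (fun k y => y + F k xs) 0)) => [xs|].
  by elim: (n xs) => [|k IH] /=; rewrite ?big_ord0 // big_ord_recr IH.
apply: (@computable_iteri _ _ _ (fun k y xs => y + F k xs)) => //.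
  exact: computable_const.
by apply: computable_add => //; apply: computable_nth.
Qed.

Lemma computable_mul m f g :
  computable m f -> computable m g -> computable m (fun xs => f xs * g xs).
Proof.
apply: computable_app2.
apply: (@eq_computable _ (fun xs =>
  \sum_(i < nth 0 xs 0) nth 0 xs 1)) => [xs|].
  by rewrite sum_nat_const card_ord.
apply: (@computable_sum 2 _ (fun _ xs => nth 0 xs 1)); first exact: computable_nth.
exact: computable_nth_drop.
Qed.

Lemma computable_exp m f g :
  computable m f -> computable m g -> computable m (fun xs => f xs ^ g xs).
Proof.
apply: computable_app2.
apply: (@eq_computable _ (fun xs =>
  iteri (nth 0 xs 1) (fun _ y => nth 0 xs 0 * y) 1)) => [xs|].
  by elim: (nth 0 xs 1) => //= n ->; rewrite expnS.
apply: (@computable_iteri 2 _ _ (fun _ y xs => nth 0 xs 0 * y)).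
- exact: computable_nth.
- exact: computable_const.
- apply: computable_mul; [exact: computable_nth_drop | exact: computable_nth].
Qed.

Lemma computable_pred m f : computable m f -> computable m (fun xs => (f xs).-1).
Proof.
apply: computable_app1.
apply: (@eq_computable _ (fun xs =>
  iteri (nth 0 xs 0) (fun k _ => k) 0)) => [xs|]; first by case: (nth 0 xs 0).
apply: (@computable_iteri 1 _ _ (fun k _ _ => k)); try exact: computable_nth.
exact: computable_const.
Qed.

Lemma computable_sub m f g :
  computable m f -> computable m g -> computable m (fun xs => f xs - g xs).
Proof.
apply: computable_app2.
apply: (@eq_computable _ (fun xs =>
  iteri (nth 0 xs 1) (fun _ y => y.-1) (nth 0 xs 0))) => [xs|].
  by elim: (nth 0 xs 1) => [|n /= ->]; [rewrite subn0 | rewrite subnS].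
apply: (@computable_iteri 2 _ _ (fun _ y _ => y.-1)); try exact: computable_nth.
by apply: computable_pred; apply: computable_nth.
Qed.

Lemma computable_leq m f g :
  computable m f -> computable m g ->
  computable m (fun xs => nat_of_bool (f xs <= g xs)).
Proof.
move=> fP gP; apply: (@eq_computable _ (fun xs => 1 - (f xs - g xs))).
  by move=> xs; rewrite /leq; case: (f xs - g xs).
by apply: computable_sub; [apply: computable_const | apply: computable_sub].
Qed.

Lemma computable_eq m f g :
  computable m f -> computable m g ->
  computable m (fun xs => nat_of_bool (f xs == g xs)).
Proof.
move=> fP gP.
apply: (@eq_computable _ (fun xs => (f xs <= g xs) * (g xs <= f xs))).
  by move=> xs; rewrite eqn_leq; do 2![case: (_ <= _)].
by apply: computable_mul; apply: computable_leq.
Qed.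

(** Recovers a number by counting the indices below it, so that quotients and 2-adic valuations
    become bounded sums. *)
Lemma sum_ltn n x : x <= n -> \sum_(i < n) (i < x) = x.
Proof.
move=> /minn_idPr {2}<-.
by elim: n => [|n IH]; rewrite ?big_ord0 ?min0n // big_ord_recr /= IH; lia.
Qed.

Lemma computable_div m f g :
  computable m f -> computable m g -> computable m (fun xs => f xs %/ g xs).
Proof.
apply: computable_app2.
(* The quotient counts the positive multiples of the divisor up to the dividend; the first factor
   implements the convention that division by zero gives 0. *)
apply: (@eq_computable _ (fun xs => (0 < nth 0 xs 1) *
  \sum_(i < nth 0 xs 0) (i.+1 * nth 0 xs 1 <= nth 0 xs 0))) => [xs|].
  case: posnP => [->|b_gt0]; first by rewrite divn0.
  rewrite mul1n -[RHS](@sum_ltn (nth 0 xs 0)) ?leq_div //.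
  by apply: eq_bigr => i _; rewrite -leq_divRL.
apply: computable_mul.
  by apply: computable_leq; [apply: computable_const | apply: computable_nth].
apply: (@computable_sum 2 _ (fun i xs => i.+1 * nth 0 xs 1 <= nth 0 xs 0)).
  exact: computable_nth.
apply: computable_leq; last exact: computable_nth_drop.
apply: computable_mul; last exact: computable_nth_drop.
by apply: computable_succ; apply: computable_nth.
Qed.

Lemma computable_mod m f g :
  computable m f -> computable m g -> computable m (fun xs => f xs %% g xs).
Proof.
move=> fP gP; apply: (@eq_computable _ (fun xs => f xs - f xs %/ g xs * g xs)).
  by move=> xs; rewrite {1}(divn_eq (f xs) (g xs)) addKn.
by do ?[apply: computable_sub | apply: computable_mul | apply: computable_div].
Qed.

(** * Numbers as sequences of digits *)

Definition digit (b w i : nat) : nat := w %/ b ^ i %% b.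

Definition digit_sum (b : nat) (f : nat -> nat) (n : nat) : nat :=
  \sum_(i < n) f i * b ^ i.

Lemma digit_sum_lt b f n :
  (forall i, i < n -> f i < b) -> digit_sum b f n < b ^ n.
Proof.
rewrite /digit_sum; elim: n => [|n IH] fb; first by rewrite big_ord0.
rewrite big_ord_recr /= expnS.
have := IH (fun i lt_in => fb i (ltnW lt_in)); have := fb n (ltnSn n).
set S := \sum_(_ < n) _; nia.
Qed.

(** The top term either is the digit sought, the rest being below [b ^ n], or is a multiple of
    [b ^ i.+1] and does not affect digit [i]. *)
Lemma digit_sumK b f n i :
  (forall i, i < n -> f i < b) -> i < n -> digit b (digit_sum b f n) i = f i.
Proof.
rewrite /digit; elim: n => // n IH fb; rewrite ltnS leq_eqVlt.
have b_gt0 : 0 < b by apply: leq_ltn_trans (fb n (ltnSn n)).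
have Sn : digit_sum b f n.+1 = f n * b ^ n + digit_sum b f n.
  by rewrite /digit_sum big_ord_recr addnC.
have fb' j : j < n -> f j < b by move=> /ltnW; apply: fb.
case/orP=> [/eqP->|lt_in].
  rewrite Sn divnMDl ?expn_gt0 ?b_gt0 // divn_small ?digit_sum_lt // addn0.
  by rewrite modn_small ?fb.
have -> : digit_sum b f n.+1 = f n * b ^ (n - i.+1) * b * b ^ i + digit_sum b f n.
  by rewrite Sn -[in b ^ n](subnK lt_in) expnD expnS !mulnA.
by rewrite divnMDl ?expn_gt0 ?b_gt0 // modnMDl IH.
Qed.

Lemma computable_digit m f g h :
  computable m f -> computable m g -> computable m h ->
  computable m (fun xs => digit (f xs) (g xs) (h xs)).
Proof.
by move=> *; do ?[apply: computable_mod | apply: computable_div | apply: computable_exp].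
Qed.

(** * Arithmetic on sequence codes *)

Definition code_cons (x n : nat) : nat := 2 ^ x * n.*2.+1.
(** As [CodeSeq.code (x :: s)] is 2^x (2m + 1) with m the code of [s], the head is the 2-adic
    valuation, and the tail is read off the odd part. *)
Definition code_head (n : nat) : nat := \sum_(i < n) (n %% 2 ^ i.+1 == 0).
Definition code_tail (n : nat) : nat := (n %/ 2 ^ code_head n).-1 %/ 2.

Lemma code_consE x s : CodeSeq.code (x :: s) = code_cons x (CodeSeq.code s).
Proof. by []. Qed.

Lemma code_head_cons x s : code_head (CodeSeq.code (x :: s)) = x.
Proof.
rewrite code_consE /code_cons; set m := CodeSeq.code s.
set n := 2 ^ x * _; have le_xn : x <= n.
  by rewrite (leq_trans (ltnW (ltn_expl x (ltnSn 1)))) // leq_pmulr.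
rewrite -[RHS](sum_ltn le_xn); apply: eq_bigr => i _; congr nat_of_bool.
rewrite -/(dvdn _ _) /n; case: (ltnP i x) => [lt_ix|le_xi].
  by rewrite dvdn_mulr // dvdn_exp2l.
rewrite -(subnKC le_xi) -addnS expnD dvdn_pmul2l ?expn_gt0 //.
apply/negP=> /(dvdn_trans (dvdn_exp2l 2 (ltn0Sn _))).
by rewrite expn1 dvdn2 /= odd_double.
Qed.

Lemma code_tail_cons x s : code_tail (CodeSeq.code (x :: s)) = CodeSeq.code s.
Proof.
rewrite /code_tail code_head_cons code_consE /code_cons mulKn ?expn_gt0 //=.
by rewrite divn2 doubleK.
Qed.

Lemma computable_cons m f g :
  computable m f -> computable m g -> computable m (fun xs => code_cons (f xs) (g xs)).
Proof.
move=> fP gP; apply: (@eq_computable _ (fun xs => 2 ^ f xs * (2 * g xs).+1)).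
  by move=> xs; rewrite mul2n.
by do ?[apply: computable_mul | apply: computable_exp | apply: computable_succ |
        apply: computable_const].
Qed.

Lemma computable_code m f (s : seq nat -> seq nat) :
  computable m f -> computable m (fun xs => CodeSeq.code (s xs)) ->
  computable m (fun xs => CodeSeq.code (f xs :: s xs)).
Proof. exact: computable_cons. Qed.

Lemma computable_head m f : computable m f -> computable m (fun xs => code_head (f xs)).
Proof.
apply: computable_app1.
apply: (@computable_sum 1 _ (fun i xs => nth 0 xs 0 %% 2 ^ i.+1 == 0)).
  exact: computable_nth.
by do ?[apply: computable_eq | apply: computable_mod | apply: computable_exp
  | apply: computable_succ | apply: computable_const | apply: computable_nth
  | apply: computable_nth_drop].
Qed.

Lemma computable_tail m f : computable m f -> computable m (fun xs => code_tail (f xs)).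
Proof.
move=> fP; apply: computable_div; last exact: computable_const.
apply: computable_pred; apply: computable_div => //.
by apply: computable_exp; [apply: computable_const | apply: computable_head].
Qed.

(** A right fold consumes the indices from the top: iteration [k] handles the index [n - k.+1]. *)
Lemma computable_foldr m n y0 (g : nat -> nat -> seq nat -> nat) :
  computable m n -> computable m y0 ->
  computable m.+2 (fun ys => g (n (drop 2 ys) - (nth 0 ys 0).+1) (nth 0 ys 1) (drop 2 ys)) ->
  computable m (fun xs => foldr (fun i y => g i y xs) (y0 xs) (iota 0 (n xs))).
Proof.
move=> nP y0P gP; apply: (@eq_computable _ (fun xs =>
  iteri (n xs) (fun k y => g (n xs - k.+1) y xs) (y0 xs))) => [xs|].
  set N := n xs; suff H k : k <= N -> iteri k (fun k y => g (N - k.+1) y xs) (y0 xs) =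
      foldr (fun i y => g i y xs) (y0 xs) (iota (N - k) k) by rewrite H // subnn.
  by elim: k => // k IH lt_kn /=; rewrite IH ?(ltnW lt_kn) // subnSK.
exact: (@computable_iteri m n y0 (fun k y xs => g (n xs - k.+1) y xs)).
Qed.

Lemma computable_exists m n (F : nat -> seq nat -> bool) :
  computable m n ->
  computable m.+2 (fun ys => nat_of_bool (F (nth 0 ys 0) (drop 2 ys))) ->
  computable m (fun xs => nat_of_bool [exists i : 'I_(n xs), F i xs]).
Proof.
move=> nP FP.
apply: (@eq_computable _ (fun xs => nat_of_bool (0 < \sum_(i < n xs) F i xs))) => [xs|].
  congr nat_of_bool; rewrite lt0n sum_nat_eq0 negb_forall; apply: eq_existsb => i /=.
  by case: (F i xs).
apply: computable_leq; first exact: computable_const.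
exact: (@computable_sum m n (fun i xs => nat_of_bool (F i xs))).
Qed.

Ltac computable := repeat first
  [ assumption
  | apply: computable_const | apply: computable_nth | apply: computable_nth_drop
  | apply: computable_code | apply: computable_cons
  | apply: computable_head | apply: computable_tail
  | apply: computable_digit | apply: computable_exp
  | apply: computable_add | apply: computable_mul | apply: computable_sub
  | apply: computable_succ | apply: computable_eq | apply: computable_leq ].

Lemma computableP1 f :
  computable 1 f -> exists c, forall n, reval c [:: n] (f [:: n]).
Proof. by case=> c cP; exists c => n; apply: (cP [:: n]). Qed.

Definition code_at (i n : nat) : nat := code_head (iter i code_tail n).

(** Reading past the end agrees with the default of [nth], because 0 codes the empty list and is its
    own head and tail. *)
Lemma code_atE s i : code_at i (CodeSeq.code s) = nth 0 s i.
Proof.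
have head0 : code_head 0 = 0 by rewrite /code_head big_ord0.
have tail0 : code_tail 0 = 0 by rewrite /code_tail div0n.
rewrite /code_at; elim: i s => [|i IH] [|x s] //=; first exact: code_head_cons.
  by rewrite -iterS iterSr tail0 (IH [::]) nth_nil.
by rewrite -iterS iterSr code_tail_cons IH.
Qed.

Lemma computable_at m i f : computable m f -> computable m (fun xs => code_at i (f xs)).
Proof.
move=> fP; apply: computable_head.
by elim: i => [//|i IH]; apply: computable_tail.
Qed.

(** Subformulae and variables are thus smaller than the codes containing them, which justifies
    recursion on codes and bounds on variables. *)
Lemma nth_code_lt s i : i < size s -> nth 0 s i < CodeSeq.code s.
Proof. by move=> lt_is; apply: (allP (CodeSeq.ltn_code s)); apply: mem_nth. Qed.

Lemma leq_code_cons x y m n : x <= y -> m <= n -> code_cons x m <= code_cons y n.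
Proof. by move=> le_xy le_mn; rewrite leq_mul ?leq_exp2l // ltnS leq_double. Qed.

Lemma ltn_code_cons x y m n : x < y -> m <= n -> code_cons x m < code_cons y n.
Proof.
move=> lt_xy le_mn; apply: (leq_ltn_trans (leq_code_cons (leqnn x) le_mn)).
by rewrite ltn_pmul2r // ltn_exp2l.
Qed.

Lemma eq_map_enum n (f g : 'I_n -> nat) :
  [seq f k | k <- enum 'I_n] = [seq g k | k <- enum 'I_n] -> f =1 g.
Proof. by move=> /eq_in_map fg k; apply: fg; rewrite mem_enum. Qed.

(** * The theory of records *)

(* The atom [p x a b c] reads: the node x is a record with tag p and fields
   a, b, c. *)
Definition record_sig : signature :=
  @Signature void (fun=> 0) 'I_15 (fun=> 4).
Definition records : theory := @Theory record_sig (fun=> True).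

Definition var_of (V : Type) (t : term record_sig V) : V :=
  match t with
  | Var x => x
  | Fn f _ => match (f : void) with end
  end.

Lemma var_ofK V : cancel (@var_of V) (@Var record_sig V).
Proof. by case=> // -[]. Qed.

Lemma teval_var V (M : structure record_sig) (v : V -> M) t :
  teval v t = v (var_of t).
Proof. by rewrite -[t in LHS]var_ofK. Qed.

Lemma code_term_var V (cV : V -> nat) (t : term record_sig V) :
  code_term cV t = CodeSeq.code [:: 0; cV (var_of t)].
Proof. by rewrite -[t in LHS]var_ofK. Qed.

Lemma enum_ord4 : enum 'I_4 = [:: inord 0; inord 1; inord 2; inord 3].
Proof. by apply: (inj_map val_inj); rewrite val_enum_ord /= !inordK. Qed.

Lemma computable_code_vars :
  computable 1 (fun xs =>
    CodeSeq.code [seq CodeSeq.code [:: 0; i] | i <- iota 0 (nth 0 xs 0)]).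
Proof.
pose g i y (_ : seq nat) := code_cons (code_cons 0 (code_cons i 0)) y.
apply: (@eq_computable _ (fun xs =>
  foldr (fun i y => g i y xs) 0 (iota 0 (nth 0 xs 0)))) => [xs|].
  by elim: (iota _ _) => //= i s ->.
by apply: computable_foldr; rewrite /g; computable.
Qed.

Lemma records_locally_finite : locally_finite records.
Proof.
split.
  by split; [exists [::]; case | exists (enum 'I_15) => p; rewrite mem_enum].
exists (fun n => [seq Var i | i <- enum 'I_n]), (fun n u => u); split.
- have [c cP] := computableP1 computable_code_vars; exists c => n.
  have /= := cP n; rewrite -val_enum_ord -map_comp => H.
  by rewrite -map_comp.
- by exists (RProj 1).
- move=> n u; split=> //; rewrite -(var_ofK u).
  have := mem_enum 'I_n (var_of u).
  by elim: (enum _) => //= i s IH; rewrite inE => /predU1P[->|/IH]; [left | right].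
Qed.

Lemma records_closed_under_substructures : closed_under_substructures records.
Proof. by []. Qed.

(* A pair of numbers (w, r) presents a structure on the natural numbers, in which
   the variable x has as value the x-th digit of w in base b, and the true atoms
   are the ones whose code is an element of the bit set r. *)
Definition code_structure (r : nat) : structure record_sig :=
  @Structure record_sig nat (inhabits 0) (fun f _ => match (f : void) with end)
    (fun p xs =>
       0 < digit 2 r (CodeSeq.code (pickle p :: [seq xs k | k <- enum 'I_4]))).

Definition code_val (b w t : nat) : nat := digit b w (code_at 1 t).

(** A case distinction on the constructor number, written as a sum of products to be visibly
    computable; the nested [code_cons] is the code of an atom in [code_structure]. *)
Definition code_atom_holds (b w r q : nat) : nat :=
  (code_at 0 q == 0) *
    (code_val b w (code_at 1 q) == code_val b w (code_at 2 q)) +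
  (code_at 0 q == 1) *
    digit 2 r (code_cons (code_at 1 q)
      (code_cons (code_val b w (code_at 2 q))
      (code_cons (code_val b w (code_at 3 q))
      (code_cons (code_val b w (code_at 4 q))
      (code_cons (code_val b w (code_at 5 q)) 0))))).

(* [H] is the bit set of the codes less than n of true formulae. *)
Definition code_holds_step (b w r n H : nat) : nat :=
  (code_at 0 n == 0) * code_atom_holds b w r (code_at 1 n) +
  (code_at 0 n == 2) * (1 - digit 2 H (code_at 1 n)) +
  (code_at 0 n == 3) * (digit 2 H (code_at 1 n) * digit 2 H (code_at 2 n)) +
  (code_at 0 n == 4) * (digit 2 H (code_at 1 n) + digit 2 H (code_at 2 n)).

(** Course-of-values recursion: a subformula has a smaller code, so its truth value is already a
    stored bit. *)
Definition code_history (b w r n : nat) : nat :=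
  iteri n (fun k H => H + (0 < code_holds_step b w r k H) * 2 ^ k) 0.

Arguments code_history : simpl never.

Definition code_holds (b w r n : nat) : bool :=
  0 < code_holds_step b w r n (code_history b w r n).

Lemma digit_code_history b w r n i :
  i < n -> digit 2 (code_history b w r n) i = code_holds b w r i.
Proof.
have -> : code_history b w r n = digit_sum 2 (code_holds b w r) n.
  elim: n => [|n IH]; rewrite /digit_sum ?big_ord0 // big_ord_recr /= -/(digit_sum _ _ n).
  by rewrite /code_history /= -/(code_history b w r n) IH /code_holds IH.
by move=> lt_in; rewrite digit_sumK // => j _; case: code_holds.
Qed.

Lemma code_holdsP b w r (phi : qf record_sig nat) :
  code_holds b w r (code_qf phi) <->
  qf_holds (M := code_structure r) (digit b w) phi.
Proof.
elim: phi => [a| |p IHp|p IHp q IHq|p IHp q IHq].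
- rewrite /code_holds /code_holds_step /qf_holds [code_qf _]/= !code_atE /=.
  rewrite mul1n !addn0 /code_atom_holds.
  case: a => [t u|p ts].
    rewrite [code_atom _ _]/= !code_atE /= /code_val !code_term_var !code_atE /=.
    rewrite !teval_var mul1n addn0; split; first by rewrite lt0b => /eqP.
    by move->; rewrite eqxx.
  rewrite /code_atom enum_ord4 /= !code_atE /= mul0n mul1n add0n.
  rewrite /code_val !code_term_var !code_atE /= enum_ord4 /=.
  by rewrite !teval_var.
- by rewrite /code_holds /code_holds_step [code_qf _]/= !code_atE.
- rewrite /code_holds /code_holds_step.
  have lt_n := @nth_code_lt [:: 2; code_qf p].
  rewrite -[code_qf (QNot p)]/(CodeSeq.code [:: 2; code_qf p]) !code_atE.
  rewrite digit_code_history; last exact: (lt_n 1).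
  rewrite mul1n !addn0 mul0n add0n -[nth 0 _ 1]/(code_qf p).
  rewrite -[qf_holds _ (QNot p)]/(~ qf_holds (M := code_structure r) (digit b w) p) -IHp.
  by case: code_holds; split.
- rewrite /code_holds /code_holds_step.
  have lt_n := @nth_code_lt [:: 3; code_qf p; code_qf q].
  rewrite -[code_qf (QAnd p q)]/(CodeSeq.code [:: 3; code_qf p; code_qf q]) !code_atE.
  rewrite !digit_code_history; [|exact: (lt_n 2)|exact: (lt_n 1)].
  rewrite mul1n !addn0 !mul0n !add0n -[nth 0 _ 1]/(code_qf p) -[nth 0 _ 2]/(code_qf q).
  rewrite -[qf_holds _ (QAnd p q)]/(qf_holds (M := code_structure r) (digit b w) p /\
    qf_holds (M := code_structure r) (digit b w) q) -IHp -IHq.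
  by do 2![case: code_holds]; split=> // -[].
- rewrite /code_holds /code_holds_step.
  have lt_n := @nth_code_lt [:: 4; code_qf p; code_qf q].
  rewrite -[code_qf (QOr p q)]/(CodeSeq.code [:: 4; code_qf p; code_qf q]) !code_atE.
  rewrite !digit_code_history; [|exact: (lt_n 2)|exact: (lt_n 1)].
  rewrite mul1n !mul0n !add0n -[nth 0 _ 1]/(code_qf p) -[nth 0 _ 2]/(code_qf q).
  rewrite -[qf_holds _ (QOr p q)]/(qf_holds (M := code_structure r) (digit b w) p \/
    qf_holds (M := code_structure r) (digit b w) q) -IHp -IHq.
  by do 2![case: code_holds]; split; by [case | move=> _; left | move=> _; right].
Qed.

Lemma computable_code_holds m f g h k :
  computable m f -> computable m g -> computable m h -> computable m k ->
  computable m (fun xs => nat_of_bool (code_holds (f xs) (g xs) (h xs) (k xs))).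
Proof.
apply: (@computable_app4 m (fun b w r n => nat_of_bool (code_holds b w r n))).
have stepP l f' g' h' k' H' : computable l f' -> computable l g' -> computable l h' ->
    computable l k' -> computable l H' -> computable l (fun xs =>
      nat_of_bool (0 < code_holds_step (f' xs) (g' xs) (h' xs) (k' xs) (H' xs))).
  move=> *; rewrite /code_holds_step /code_atom_holds /code_val.
  by do ?[apply: computable_leq | progress computable | apply: computable_at].
apply: stepP; try exact: computable_nth.
apply: (@computable_iteri 4 _ _ (fun k H xs =>
  H + (0 < code_holds_step (nth 0 xs 0) (nth 0 xs 1) (nth 0 xs 2) k H) * 2 ^ k)).
- exact: computable_nth.
- exact: computable_const.
- by computable; apply: stepP; computable.
Qed.

(** The exponent exceeds the code of every atom with tag below [n] and four values at most [n], so
    every set of such atoms is a bit set below the bound. *)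
Definition model_bound (n : nat) : nat :=
  2 ^ code_cons n (code_cons n (code_cons n (code_cons n (code_cons n 0)))).

(** The code [n] of a formula bounds its variables, and the [n]-digit numbers in base [n] list all
    assignments of values below [n] to them. *)
Definition code_sat (n : nat) : bool :=
  [exists w : 'I_(n ^ n), exists r : 'I_(model_bound n), code_holds n w r n].

Lemma computable_code_sat : computable 1 (fun xs => nat_of_bool (code_sat (nth 0 xs 0))).
Proof.
apply: (@computable_exists 1 (fun xs => nth 0 xs 0 ^ nth 0 xs 0) (fun w xs =>
  [exists r : 'I_(model_bound (nth 0 xs 0)), code_holds (nth 0 xs 0) w r (nth 0 xs 0)])).
  by computable.
apply: (@computable_exists 3 (fun ys => model_bound (nth 0 (drop 2 ys) 0)) (fun r ys =>
  code_holds (nth 0 (drop 2 ys) 0) (nth 0 ys 0) r (nth 0 (drop 2 ys) 0))).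
  by rewrite /model_bound; computable.
apply: computable_code_holds; try exact: computable_nth; try exact: computable_nth_drop.
(* Each of the two nested searches prepends a counter and an accumulator, which moves the original
   argument to position 4. *)
all: apply: (@eq_computable _ (fun ys => nth 0 ys 4)); try exact: computable_nth.
all: by move=> xs; rewrite !nth_drop.
Qed.

(** * Small model property *)

Definition decide (P : Prop) : bool :=
  if excluded_middle_informative P then true else false.

Lemma decideP (P : Prop) : reflect P (decide P).
Proof. by rewrite /decide; case: excluded_middle_informative => h; constructor. Qed.

(** Names each value by the least variable denoting it, so that elements of an arbitrary model
    become numbers bounded by the variables. *)
Lemma least_representative (X : Type) (v : nat -> X) :
  exists h : nat -> nat, (forall x, h x <= x) /\ (forall x y, h x = h y <-> v x = v y)
    /\ (forall x, v (h x) = v x).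
Proof.
have ex x : exists y, decide (v y = v x) by exists x; apply/decideP.
exists (fun x => ex_minn (ex x)).
have vh x : v (ex_minn (ex x)) = v x by case: ex_minnP => y /decideP.
split; [|split] => //.
  by move=> x; case: ex_minnP => y _; apply; apply/decideP.
move=> x y; split=> [hxy|vxy]; first by rewrite -vh hxy vh.
case: ex_minnP => a /decideP va aP; case: ex_minnP => b /decideP vb bP.
by apply/eqP; rewrite eqn_leq; apply/andP; split;
  [apply: aP | apply: bP]; apply/decideP; congruence.
Qed.

(** A quantifier-free formula only sees the values of its variables. Named by least variables and
    equipped with the relations pulled back from the model, these give a structure within the bounds
    of [code_sat]. *)
Lemma records_sat (phi : qf record_sig nat) :
  code_sat (code_qf phi) <-> qf_satisfiable (T := records) phi.
Proof.
split.
  case/existsP=> w /existsP[r /code_holdsP H].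
  by exists (code_structure r), (digit (code_qf phi) w).
case=> M [v [_ phiM]].
have [h [h_le [hE vh]]] := least_representative v.
set n := code_qf phi; pose w := digit_sum n h n.
pose L := code_cons n (code_cons n (code_cons n (code_cons n (code_cons n 0)))).
pose R i := decide (exists (p : 'I_15) (xs : 'I_4 -> nat),
  i = CodeSeq.code (pickle p :: [seq xs k | k <- enum 'I_4]) /\
  @pint record_sig M p (fun k => v (xs k))).
pose r := digit_sum 2 R L.
have hn x : x < n -> h x < n by apply: leq_ltn_trans.
have w_lt : w < n ^ n by apply: digit_sum_lt => x /hn.
have r_lt : r < model_bound n by apply: digit_sum_lt => i _; case: (R i).
suff H : code_holds n w r n by apply/existsP; exists (Ordinal w_lt);
  apply/existsP; exists (Ordinal r_lt).
apply/code_holdsP; move: phiM; rewrite /qf_holds.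
have wE x : x < n -> digit n w x = h x by move=> ltxn; rewrite digit_sumK.
(* The induction is over formulae with code at most [n]; this bound passes to subformulae and keeps
   their variables below [n]. *)
suff /(_ phi (leqnn _)) [] : forall psi : qf record_sig nat, code_qf psi <= n ->
    (qholds (atom_holds v) psi <->
     qholds (atom_holds (M := code_structure r) (digit n w)) psi) by [].
have lt_n s i : i < size s -> CodeSeq.code s <= n -> nth 0 s i < n.
  by move=> lt_is; apply: leq_trans (nth_code_lt lt_is).
have var_lt (t : term record_sig nat) : code_term id t < n -> var_of t < n.
  by rewrite code_term_var => /ltnW /(@lt_n _ 1); apply.
elim=> [a| |p IHp|p IHp q IHq|p IHp q IHq] //= le_n.
- have {}le_n : code_atom id a <= n := ltnW (lt_n [:: 0; code_atom id a] 1 isT le_n).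
  case: a le_n => [t u|p ts] le_n.
    pose s := [:: 0; code_term id t; code_term id u].
    have t_lt := var_lt t (lt_n s 1 isT le_n); have u_lt := var_lt u (lt_n s 2 isT le_n).
    by rewrite /= !teval_var !wE // hE.
  pose s := [:: 1, pickle p & [seq code_term id (ts k) | k <- enum 'I_4]].
  have p_lt : pickle p < n := lt_n s 1 isT le_n.
  have ts_lt k : var_of (ts k) < n.
    apply: var_lt; have := lt_n s k.+2; rewrite /= size_map size_enum_ord.
    move=> /(_ (ltn_ord k) le_n).
    by rewrite (nth_map k) ?size_enum_ord // nth_ord_enum.
  have E : (fun k => teval (M := code_structure r) (digit n w) (ts k)) =
            (fun k => h (var_of (ts k))).
    by apply: functional_extensionality => k; rewrite teval_var wE.
  rewrite /atom_holds E /= digit_sumK; last 2 first.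
  - by move=> i _; case: (R i).
  - have hs_le k : h (var_of (ts k)) <= n by rewrite ltnW // hn.
    rewrite enum_ord4 /=.
    by rewrite !code_consE; apply: ltn_code_cons => //; do ![apply: leq_code_cons => //].
  rewrite lt0b; split=> [pM|/decideP[q [xs [/(can_inj CodeSeq.codeK) [Ep Es] pM]]]].
    apply/decideP; exists p, (fun k => h (var_of (ts k))); split=> //.
    move: pM; congr pint; apply: functional_extensionality => k.
    by rewrite teval_var vh.
  have Ek (k : 'I_4) : h (var_of (ts k)) = xs k.
    exact: (@eq_map_enum 4 (fun k => h (var_of (ts k))) xs Es).
  move: Ep => /(pcan_inj pickleK) Ep; rewrite Ep; move: pM; congr pint.
  by apply: functional_extensionality => k; rewrite -Ek teval_var vh.
- by rewrite (IHp (ltnW (lt_n [:: 2; code_qf p] 1 isT le_n))).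
- pose s := [:: 3; code_qf p; code_qf q].
  by rewrite (IHp (ltnW (lt_n s 1 isT le_n))) (IHq (ltnW (lt_n s 2 isT le_n))).
- pose s := [:: 4; code_qf p; code_qf q].
  by rewrite (IHp (ltnW (lt_n s 1 isT le_n))) (IHq (ltnW (lt_n s 2 isT le_n))).
Qed.

Lemma records_sat_decidable : qf_sat_decidable records.
Proof.
have [c cP] := computableP1 computable_code_sat; exists c => phi.
have [phiE Ephi] := records_sat phi; have /= := cP (code_qf phi).
case: code_sat phiE Ephi => phiE Ephi H; split=> // sat_phi.
  by case: sat_phi; apply: phiE.
by have := Ephi sat_phi.
Qed.

(** * Record atoms and conjunctions *)

Definition is_record (M : structure record_sig) (p : 'I_15) (x a b c : M) : Prop :=
  @pint record_sig M p (fun k => nth x [:: x; a; b; c] k).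

Definition record_atom (V : Type) (p : 'I_15) (x a b c : V) : atom record_sig V :=
  @APred record_sig V p (fun k => Var (nth x [:: x; a; b; c] k)).

Lemma record_atom_holds (M : structure record_sig) V (v : V -> M) p x a b c :
  atom_holds v (record_atom p x a b c) = is_record p (v x) (v a) (v b) (v c).
Proof.
rewrite /is_record /=; congr pint; apply: functional_extensionality => k.
by rewrite -(nth_map x (v x) v) //; apply: (ltn_ord (k : 'I_4)).
Qed.

Fixpoint All (X : Type) (P : X -> Prop) (s : seq X) : Prop :=
  if s is x :: s' then P x /\ All P s' else True.

Lemma All_map X Y (f : X -> Y) P s : All P (map f s) <-> All (fun x => P (f x)) s.
Proof. by elim: s => //= x s ->. Qed.

Lemma All_cat X (P : X -> Prop) s t : All P (s ++ t) <-> All P s /\ All P t.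
Proof. by elim: s => [|x s IH] /=; [tauto | rewrite IH; tauto]. Qed.

Lemma AllP (X : eqType) (P : X -> Prop) s : All P s <-> (forall x, x \in s -> P x).
Proof.
elim: s => //= x s ->; split=> [[Px Ps] y|Ps].
  by rewrite inE => /predU1P[->|/Ps].
by split=> [|y ys]; apply: Ps; rewrite inE ?eqxx ?ys ?orbT.
Qed.

Lemma sub_All X (P Q : X -> Prop) s : (forall x, P x -> Q x) -> All P s -> All Q s.
Proof. by move=> PQ; elim: s => //= x s IH [/PQ Qx /IH]. Qed.

Definition qconj (A : Type) (s : seq (qform A)) : qform A :=
  foldr (@QAnd A) (QNot QFalse) s.

Lemma qconj_holds A (h : A -> Prop) s : qholds h (qconj s) <-> All (qholds h) s.
Proof. by elim: s => [|p s IH] /=; [tauto | rewrite IH]. Qed.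

(** * Horn rules as array transitions *)

Variant pattern := Pattern of 'I_15 & nat & nat & nat & nat.

Definition pattern_holds (M : structure record_sig) (v : nat -> M) (q : pattern) : Prop :=
  let: Pattern p x a b c := q in is_record p (v x) (v a) (v b) (v c).

Definition pattern_form (V : Type) (f : nat -> V) (q : pattern) :
    qf2 record_sig record_sig V V :=
  let: Pattern p x a b c := q in
  QAtom (inl (record_atom p (f x) (f a) (f b) (f c))).

Lemma pattern_form_holds (MI ME : structure record_sig) V (f : nat -> V)
    (vI : V -> MI) (vE : V -> ME) q :
  qf2_holds vI vE (pattern_form f q) <-> pattern_holds (fun x => vI (f x)) q.
Proof. by case: q => *; rewrite /pattern_holds -(record_atom_holds (fun x => vI x)). Qed.

Definition tag_true : 'I_15 := @Ordinal 15 14 isT.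

(** The element signature has no constants, so a node counts as marked when its array value equals
    that of a true node. *)
Definition is_true_node (M : structure record_sig) (x : M) : Prop :=
  is_record tag_true x x x x.

(* In a rule, the variable 0 is a true node, and the variable 1 is the conclusion. *)
Record rule := Rule { rule_patterns : seq pattern; rule_premises : seq nat }.

Definition elem_eq (V : Type) (x y : V) : qf2 record_sig record_sig V V :=
  QAtom (inr (AEq (Var x) (Var y))).

Definition index_eq (V : Type) (x y : V) : qf2 record_sig record_sig V V :=
  QAtom (inl (AEq (Var x) (Var y))).

(** No rule of [eval_rules] uses a variable above 15, so one block of 16 index variables serves all
    transitions. *)
Definition rule_var (x : nat) : 'I_16 := inord x.

Definition rule_guard (r : rule) : qf2 record_sig record_sig 'I_16 'I_16 :=
  QAnd (pattern_form rule_var (Pattern tag_true 0 0 0 0))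
    (QAnd (qconj [seq pattern_form rule_var q | q <- rule_patterns r])
          (qconj [seq elem_eq (rule_var x) (rule_var 0) | x <- rule_premises r])).

(** The cell of the conclusion will receive the value of the true node, and every other cell is
    kept. *)
Definition update_guard (k : 'I_2) : guard records records 16 :=
  if k == ord0 then index_eq None (Some (rule_var 1))
  else QNot (index_eq None (Some (rule_var 1))).

Definition update_term (k : 'I_2) : update records 16 :=
  if k == ord0 then Var (Some (rule_var 0)) else Var None.

Lemma update_partition : partition_mod update_guard.
Proof.
move=> M i e j d; rewrite /guard_holds /update_guard; split.
  have [ji|ji] := excluded_middle_informative (j = i (rule_var 1)).
    by exists ord0; rewrite eqxx.
  by exists ord_max.
move=> k l kl; have [/eqP Ek|nk] := boolP (k == ord0);
  have [/eqP El|nl] := boolP (l == ord0).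
- by case: kl; rewrite Ek El.
- by case.
- by case.
- case: kl; apply: val_inj; move: (ltn_ord k) (ltn_ord l) nk nl.
  by rewrite -!val_eqE /=; lia.
Qed.

Definition rule_transition (r : rule) : transition records records :=
  @Transition records records 16 (rule_guard r)
    (CaseDefined update_term update_partition).

Definition same_record (p q : 'I_15) : qf2 record_sig record_sig 'I_7 'I_7 :=
  let x k : 'I_7 := inord k in
  if p == q then
    QAnd (index_eq (x 1) (x 4)) (QAnd (index_eq (x 2) (x 5)) (index_eq (x 3) (x 6)))
  else QFalse.

(** Variable 0 is a node, and variables 1 to 3 and 4 to 6 are two candidates for its fields. Tags
    are compared outside the formula, with one instance for each pair of tags. *)
Definition functional_form (p q : 'I_15) : qf2 record_sig record_sig 'I_7 'I_7 :=
  let x k : 'I_7 := inord k in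
  QNot (QAnd (QAnd (QAtom (inl (record_atom p (x 0) (x 1) (x 2) (x 3))))
                   (QAtom (inl (record_atom q (x 0) (x 4) (x 5) (x 6)))))
             (QNot (same_record p q))).

(** Makes the initially marked nodes exactly the true ones; in particular all true nodes start with
    a common value. *)
Definition init_true_form : qf2 record_sig record_sig 'I_7 'I_7 :=
  let x k : 'I_7 := inord k in
  let true_node k := QAtom (inl (record_atom tag_true (x k) (x k) (x k) (x k))) in
  QNot (QAnd (true_node 0) (QNot (QOr (QAnd (true_node 1) (elem_eq (x 0) (x 1)))
    (QAnd (QNot (true_node 1)) (QNot (elem_eq (x 0) (x 1))))))).

Definition init_matrix : qf2 record_sig record_sig 'I_7 'I_7 :=
  QAnd (qconj [seq qconj [seq functional_form p q | q <- enum 'I_15] | p <- enum 'I_15])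
       init_true_form.

Definition functional (M : structure record_sig) : Prop :=
  forall p q (x a b c a' b' c' : M),
    is_record p x a b c -> is_record q x a' b' c' ->
    [/\ p = q, a = a', b = b' & c = c'].

Lemma functional_form_holds (M E : structure record_sig) (e : 'I_7 -> E) p q
    (i : 'I_7 -> M) :
  let x k := i (inord k) in
  qf2_holds i e (functional_form p q) <->
  (is_record p (x 0) (x 1) (x 2) (x 3) -> is_record q (x 0) (x 4) (x 5) (x 6) ->
   [/\ p = q, x 1 = x 4, x 2 = x 5 & x 3 = x 6]).
Proof.
move=> x; rewrite -!(record_atom_holds i).
set A := atom_holds _ _; set B := atom_holds _ _; set C := [/\ _, _, _ & _].
have CE : qf2_holds i e (same_record p q) <-> C.
  rewrite /same_record; have [Epq|npq] := eqVneq p q.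
    by split=> [[? [? ?]]|[? ? ? ?]]; split.
  by split=> // -[/eqP]; rewrite (negbTE npq).
rewrite -[qf2_holds _ _ _]/(~ ((A /\ B) /\ ~ qf2_holds i e (same_record p q))) CE.
by have := classic C; tauto.
Qed.

Lemma init_true_form_holds (M E : structure record_sig) (e : 'I_7 -> E) (i : 'I_7 -> M) :
  qf2_holds i e init_true_form <->
  (is_true_node (i (inord 0)) ->
   (e (inord 0) = e (inord 1) <-> is_true_node (i (inord 1)))).
Proof.
rewrite /is_true_node -!(record_atom_holds i).
set A := atom_holds _ _; set B := atom_holds _ _; set C := _ = _.
rewrite /qf2_holds -[qholds _ _]/(~ (A /\ ~ ((B /\ C) \/ (~ B /\ ~ C)))).
by have := classic A; have := classic B; have := classic C; tauto.
Qed.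

Lemma init_matrix_holds (M : array_model records records) (a : array M) :
  @forallI_holds records records M (ForallI init_matrix) a <->
  functional (index_part M) /\
  (forall t x : index_part M, is_true_node t -> (a t = a x <-> is_true_node x)).
Proof.
split=> [H|[fM tM] i].
  split=> [p q x u v w u' v' w' Hp Hq|t x tt].
    have [/qconj_holds/All_map/AllP/(_ p (mem_enum _ _)) + _] :=
      H (fun k => nth x [:: x; u; v; w; u'; v'; w'] k).
    move=> /qconj_holds/All_map/AllP/(_ q (mem_enum _ _)).
    by move/functional_form_holds; rewrite !inordK //; apply.
  have [_ /init_true_form_holds] := H (fun k => nth x [:: t; x] k).
  by rewrite !inordK //; apply.
split; last by apply/init_true_form_holds => t0; apply: tM.
apply/qconj_holds/All_map/AllP => p _; apply/qconj_holds/All_map/AllP => q _.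
by apply/functional_form_holds; apply: fM.
Qed.

(** * Runs of the system and derivations *)

Section Rules.
Variable rules : seq rule.

Definition rule_system : array_system records records :=
  @ArraySystem records records (ForallI init_matrix) (size rules)
    (fun k => rule_transition (nth (Rule [::] [::]) rules k)).

Inductive derivable (M : structure record_sig) : M -> Prop :=
| derivable_true x : is_true_node x -> derivable x
| derivable_rule k (v : nat -> M) :
    k < size rules ->
    let r := nth (Rule [::] [::]) rules k in
    is_true_node (v 0) ->
    All (pattern_holds v) (rule_patterns r) ->
    (forall x, x \in rule_premises r -> derivable (v x)) ->
    derivable (v 1).


Lemma rule_guard_holds (M E : structure record_sig) (e : 'I_16 -> E) (i : 'I_16 -> M) r :
  qf2_holds i e (rule_guard r) <->
  [/\ is_true_node (i (rule_var 0)),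
      All (pattern_holds (fun x => i (rule_var x))) (rule_patterns r)
    & forall x, x \in rule_premises r -> e (rule_var x) = e (rule_var 0)].
Proof.
set l1 := [seq pattern_form rule_var q | q <- rule_patterns r].
set l2 := [seq elem_eq (rule_var x) (rule_var 0) | x <- rule_premises r].
have E1 : qf2_holds i e (qconj l1) <->
    All (pattern_holds (fun x => i (rule_var x))) (rule_patterns r).
  rewrite /qf2_holds qconj_holds All_map.
  by split; apply: sub_All => q; rewrite -/(qf2_holds _ _ _) pattern_form_holds.
have E2 : qf2_holds i e (qconj l2) <->
    (forall x, x \in rule_premises r -> e (rule_var x) = e (rule_var 0)).
  by rewrite /qf2_holds qconj_holds All_map AllP.
have E0 := pattern_form_holds rule_var i e (Pattern tag_true 0 0 0 0).
split=> [[/E0 ? [/E1 ? /E2 ?]]|[? ? ?]]; first by split.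
by split; [apply/E0 | split; [apply/E1 | apply/E2]].
Qed.

(** The two guards are exhaustive, so the case definition leaves no freedom in interpreting the
    fresh symbol. *)
Lemma rule_update (M : array_model records records) k
    (F : ('I_16 -> index_part M) -> ('I_16 -> elem_part M) ->
         index_part M -> elem_part M -> elem_part M) :
  interprets_case (tr_update (sys_tr (a := rule_system) k)) F <->
  forall i e j d, (j = i (rule_var 1) -> F i e j d = e (rule_var 0)) /\
                  (j <> i (rule_var 1) -> F i e j d = d).
Proof.
split=> [H i e j d|H i e j d l].
  by split; [apply: (H i e j d ord0) | apply: (H i e j d ord_max)].
have [H0 H1] := H i e j d; rewrite /= /update_term /update_guard.
by case: eqP => _; [apply: H0 | apply: H1].
Qed.

(** In any model, a step changes at most the cell of its conclusion, and its guard supplies the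
    premises of a rule instance; hence only derivable nodes get marked. *)
Lemma run_sound (M : array_model records records) (F : case_functions rule_system M)
    (a : nat -> array M) n :
  (forall k, interprets_case (tr_update (sys_tr k)) (F k)) ->
  forallI_holds (sys_init rule_system) (a 0) ->
  (forall m, m < n -> step_holds F (a m) (a m.+1)) ->
  functional (index_part M) /\
  (forall t x, is_true_node t -> a n x = a n t -> derivable x).
Proof.
move=> FP /init_matrix_holds[fM tM] stepP; split=> //.
(* Strengthened invariant: the true nodes keep a common value, so being marked does not depend on
   the true node chosen for comparison. *)
suff: (forall t u, is_true_node t -> is_true_node u -> a n t = a n u) /\
      (forall t x, is_true_node t -> a n x = a n t -> derivable x) by case.
elim: n stepP => [|n IH] stepP.
  split=> [t u tt /(tM t) H|t x tt /esym /(tM t x tt)]; first exact/H.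
  exact: derivable_true.
have [m lt_mn|eqT derT] := IH; first by apply: stepP; apply: ltnW.
have [k [i [/rule_guard_holds[t0 pats prems] upd]]] := stepP n (ltnSn n).
have updE x : (x = i (rule_var 1) -> a n.+1 x = a n (i (rule_var 0))) /\
              (x <> i (rule_var 1) -> a n.+1 x = a n x).
  by rewrite upd; have /rule_update := FP k; apply.
(* A true node may itself be the conclusion of a rule; it is then overwritten with the value of a
   true node, which it already had. *)
have trueE t : is_true_node t -> a n.+1 t = a n t.
  move=> tt; have [/(proj1 (updE t)) ->|/(proj2 (updE t)) //] := classic (t = i (rule_var 1)).
  exact: eqT.
split=> [t u tt tu|t x tt]; first by rewrite !trueE //; apply: eqT.
rewrite (trueE t tt); have [Ex _|nx] := classic (x = i (rule_var 1)).
  rewrite Ex; apply: (derivable_rule (v := fun x => i (rule_var x)) (ltn_ord k)) => // y yr.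
  by apply: (derT _ _ t0); apply: prems.
by rewrite (proj2 (updE x)) //; apply: derT.
Qed.

Definition rule_bounded (r : rule) : bool :=
  all (fun q => let: Pattern _ x a b c := q in
         [&& x < 16, a < 16, b < 16 & c < 16]) (rule_patterns r)
  && all (fun x => x < 16) (rule_premises r).

Section Completeness.
Variables (N : structure record_sig) (t0 : N).
Hypotheses (fN : functional N) (tN : forall x : N, is_true_node x <-> x = t0).
Hypothesis rules_bounded : all rule_bounded rules.

Definition bool_structure : structure record_sig :=
  @Structure record_sig bool (inhabits true) (fun f _ => match (f : void) with end)
    (fun _ _ => False).

Definition bool_model : array_model records records :=
  @ArrayModel records records N bool_structure I I.

Definition bool_update : case_functions rule_system bool_model :=
  fun k i e j d => if decide (j = i (rule_var 1)) then e (rule_var 0) else d.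

Lemma bool_updateP k : interprets_case (tr_update (sys_tr k)) (@bool_update k).
Proof.
apply/rule_update => i e j d.
by rewrite /bool_update; case: decideP => Ej; split.
Qed.

Definition bool_array (A : N -> Prop) : array bool_model := fun x => decide (A x).

(** The sets of marked nodes along runs, abstracted from the arrays; they only grow, so runs for
    different premises can be chained. *)
Inductive reachable : (N -> Prop) -> Prop :=
| reachable_init : reachable (fun x => x = t0)
| reachable_step A k (v : nat -> N) :
    reachable A -> k < size rules ->
    let r := nth (Rule [::] [::]) rules k in
    v 0 = t0 ->
    All (pattern_holds v) (rule_patterns r) ->
    (forall x, x \in rule_premises r -> A (v x)) ->
    reachable (fun x => x = v 1 \/ A x).

Lemma reachable_true A : reachable A -> A t0.
Proof. by elim=> // {}A k v _ A0 *; right. Qed.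

Lemma reachable_run A : reachable A ->
  exists (n : nat) (a : nat -> array bool_model),
    [/\ forallI_holds (sys_init rule_system) (a 0),
        forall m, m < n -> step_holds (@bool_update) (a m) (a m.+1)
      & forall x, a n x = decide (A x)].
Proof.
elim=> [|{}A k v /reachable_true A0 [n [a [a0 aS an]]] lt_k r v0 pats prems].
  exists 0, (fun _ => bool_array (fun x => x = t0)); split=> //.
  apply/init_matrix_holds; split=> // t x /tN ->.
  by rewrite tN /bool_array; case: decideP => // _; case: decideP.
exists n.+1, (fun m => if m <= n then a m else bool_array (fun x => x = v 1 \/ A x)).
split=> // [m|x]; last by rewrite ltnn.
rewrite ltnS => le_mn; rewrite le_mn; case: ltnP => [lt_mn|le_nm]; first exact: aS.
have -> : m = n by apply/eqP; rewrite eqn_leq le_mn.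
have decT P : P -> decide P = true by move/decideP.
have vE x : x < 16 -> v (rule_var x) = v x by move=> lt_x; rewrite /rule_var inordK.
have /andP[patsb /allP premsb] : rule_bounded r by apply: all_nthP.
exists (Ordinal lt_k), (fun x => v x); split.
  apply/rule_guard_holds; split.
  - by rewrite vE // v0 tN.
  - elim: (rule_patterns r) pats patsb => //= -[p x a' b c] s IH [px sP].
    by case/andP=> /and4P[? ? ? ?] /(IH sP); rewrite /pattern_holds !vE.
  - move=> x xr; rewrite (vE x (premsb x xr)) vE // !an v0.
    by rewrite !decT //; apply: prems.
move=> x; rewrite /bool_update /bool_array vE //.
case: (decideP (x = v 1)) => [->|nx]; first by rewrite vE // v0 an !decT //; left.
rewrite an; case: (decideP (A x)) => [Ax|nAx]; first by rewrite decT //; right.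
by case: decideP => // -[].
Qed.

(** The starting set [A] is arbitrary so that the premises of a rule can be derived one after
    another, each from the set reached before. *)
Lemma derivable_reachable x A : derivable x -> reachable A ->
  exists B, [/\ reachable B, forall y, A y -> B y & B x].
Proof.
move=> dx; elim: dx A => [{}x /tN ->|k v lt_k r /tN v0 pats _ IH] A rA.
  by exists A; split=> //; apply: reachable_true.
suff [B [rB AB premsB]] : exists B, [/\ reachable B, forall y, A y -> B y &
    forall x, x \in rule_premises r -> B (v x)].
  exists (fun x => x = v 1 \/ B x); split; [|by right; apply: AB|by left].
  exact: reachable_step pats premsB.
elim: (rule_premises r) IH => [|y s IHs] IH; first by exists A.
have [|B [rB AB sB]] := IHs; first by move=> z zs; apply: IH; rewrite inE zs orbT.
have [||C [rC BC yC]] := IH y _ B; rewrite ?mem_head //.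
exists C; split=> // [z /AB /BC //|z].
by rewrite inE => /predU1P[->|/sB /BC].
Qed.

Lemma derivable_run x : derivable x ->
  exists (n : nat) (a : nat -> array bool_model),
    [/\ forallI_holds (sys_init rule_system) (a 0),
        forall m, m < n -> step_holds (@bool_update) (a m) (a m.+1)
      & a n x = a n t0].
Proof.
move=> dx; have [B [rB _ Bx]] := derivable_reachable dx reachable_init.
have [n [a [a0 aS an]]] := reachable_run rB; exists n, a; split=> //.
have /decideP Bx' := Bx; have /decideP B0 := reachable_true rB.
by rewrite !an Bx' B0.
Qed.

End Completeness.

(** Intended use: [ps] describes a program, [qs] its input and expected output, [w] is the
    evaluation node to be marked, and [t] a true node. *)
Definition goal_formula (n : nat) (ps qs : seq pattern) (w t : nat) :
    existsI_formula records records :=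
  @ExistsI record_sig record_sig n.+1
    (QAnd (qconj [seq pattern_form (@inord n) q | q <- ps])
      (QAnd (elem_eq (inord w) (inord t))
        (qconj [seq pattern_form (@inord n) q | q <- qs]))).

Definition pattern_bounded (n : nat) (q : pattern) : bool :=
  let: Pattern _ x a b c := q in [&& x <= n, a <= n, b <= n & c <= n].

Lemma goal_formula_holds (M : array_model records records) n ps qs w t
    (i : 'I_n.+1 -> index_part M) (a : array M) :
  holds_at (ex_matrix (goal_formula n ps qs w t)) i a <->
  let v x := i (inord x) in
  [/\ All (pattern_holds v) ps, All (pattern_holds v) qs & a (v w) = a (v t)].
Proof.
have E s : qf2_holds i (fun k => a (i k)) (qconj [seq pattern_form (@inord n) q | q <- s])
    <-> All (pattern_holds (fun x => i (inord x))) s.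
  rewrite /qf2_holds qconj_holds All_map.
  by split; apply: sub_All => q; rewrite -/(qf2_holds _ _ _) pattern_form_holds.
split=> [[/E ? [? /E ?]]|[? ? ?]]; first by split.
by split; [apply/E | split; [|apply/E]].
Qed.

Lemma unsafe_goal_sound n ps qs w t :
  (forall (M : structure record_sig) (v : nat -> M),
     All (pattern_holds v) qs -> is_true_node (v t)) ->
  unsafe rule_system (goal_formula n ps qs w t) ->
  exists (M : structure record_sig) (v : nat -> M),
    [/\ functional M, All (pattern_holds v) ps, All (pattern_holds v) qs
      & derivable (v w)].
Proof.
move=> tP [m [M [F [a [FP a0 aS [i /goal_formula_holds[psP qsP awt]]]]]]].
have [fM dM] := run_sound FP a0 aS.
exists (index_part M), (fun x => i (inord x)); split=> //.
exact: dM (tP _ _ qsP) awt.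
Qed.

Lemma unsafe_goal_complete (N : structure record_sig) (t0 : N) n ps qs w t (v : nat -> N) :
  functional N -> (forall x : N, is_true_node x <-> x = t0) ->
  all rule_bounded rules ->
  all (pattern_bounded n) ps -> all (pattern_bounded n) qs -> w <= n -> t <= n ->
  All (pattern_holds v) ps -> All (pattern_holds v) qs -> v t = t0 -> derivable (v w) ->
  unsafe rule_system (goal_formula n ps qs w t).
Proof.
move=> fN tN rb psb qsb wn tn psP qsP vt dw.
have [m [a [a0 aS aw]]] := derivable_run fN tN rb dw.
exists m, (bool_model N), (@bool_update N), a; split=> //.
  exact: bool_updateP.
exists (fun k => v k); apply/goal_formula_holds.
have vE x : x <= n -> v (inord x : 'I_n.+1) = v x by move=> le_xn; rewrite inordK.
have AllE s : all (pattern_bounded n) s -> All (pattern_holds v) s ->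
    All (pattern_holds (fun x => v (inord x : 'I_n.+1))) s.
  elim: s => //= -[p x b c d] s IH /andP[/and4P[? ? ? ?] sb] [px sP].
  by split; [rewrite /pattern_holds !vE | apply: IH].
by split; [apply: AllE | apply: AllE | rewrite !vE // vt].
Qed.

End Rules.

(** * Evaluation of recursive functions by Horn rules *)

Definition tag_zero : 'I_15 := @Ordinal 15 0 isT.
Definition tag_succ : 'I_15 := @Ordinal 15 1 isT.
Definition tag_proj0 : 'I_15 := @Ordinal 15 2 isT.
Definition tag_projS : 'I_15 := @Ordinal 15 3 isT.
Definition tag_comp : 'I_15 := @Ordinal 15 4 isT.
Definition tag_seq0 : 'I_15 := @Ordinal 15 5 isT.
Definition tag_seqS : 'I_15 := @Ordinal 15 6 isT.
Definition tag_rec : 'I_15 := @Ordinal 15 7 isT.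
Definition tag_aux : 'I_15 := @Ordinal 15 8 isT.
Definition tag_min : 'I_15 := @Ordinal 15 9 isT.
Definition tag_num0 : 'I_15 := @Ordinal 15 10 isT.
Definition tag_numS : 'I_15 := @Ordinal 15 11 isT.
Definition tag_list : 'I_15 := @Ordinal 15 12 isT.
Definition tag_eval : 'I_15 := @Ordinal 15 13 isT.

(* The record [tag_eval w p l y] states that the program p maps the list l to y;
   w is marked once this has been verified. Unused fields repeat the node itself,
   and the empty list is its own tail, with head 0. *)
Definition eval_rules : seq rule :=
  let eval := Pattern tag_eval in let list := Pattern tag_list in
  let num0 x := Pattern tag_num0 x x x x in
  let numS x y := Pattern tag_numS x y x x in
  [:: Rule [:: eval 1 2 3 4; Pattern tag_zero 2 2 2 2; num0 4] [::];
      Rule [:: eval 1 2 3 4; Pattern tag_succ 2 2 2 2; list 3 5 6 3; numS 4 5] [::];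
      Rule [:: eval 1 2 3 4; Pattern tag_proj0 2 2 2 2; list 3 4 5 3] [::];
      Rule [:: eval 1 2 3 4; Pattern tag_projS 2 5 2 2; list 3 6 7 3; eval 8 5 7 4] [:: 8];
      Rule [:: eval 1 2 3 4; Pattern tag_comp 2 5 6 2; eval 7 6 3 8; eval 9 5 8 4]
           [:: 7; 9];
      Rule [:: eval 1 2 3 4; Pattern tag_seq0 2 2 2 2; num0 5; list 4 5 4 4] [::];
      Rule [:: eval 1 2 3 4; Pattern tag_seqS 2 5 6 2; eval 7 5 3 8; eval 9 6 3 10;
               list 4 8 10 4] [:: 7; 9];
      Rule [:: eval 1 2 3 4; Pattern tag_rec 2 5 6 2; list 3 7 8 3; num0 7; eval 9 5 8 4]
           [:: 9];
      Rule [:: eval 1 2 3 4; Pattern tag_rec 2 5 6 2; list 3 7 8 3; numS 7 9;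
               list 10 9 8 10; eval 11 2 10 12; list 13 12 8 13; list 14 9 13 14;
               eval 15 6 14 4] [:: 11; 15];
      Rule [:: eval 1 2 3 4; Pattern tag_aux 2 5 2 2; num0 4] [::];
      Rule [:: eval 1 2 3 4; Pattern tag_aux 2 5 2 2; eval 6 2 3 7; list 8 7 3 8;
               eval 9 5 8 10; numS 10 11; numS 4 7] [:: 6; 9];
      Rule [:: eval 1 2 3 4; Pattern tag_min 2 5 2 2; Pattern tag_aux 5 6 5 5;
               eval 7 5 3 4; list 8 4 3 8; eval 9 6 8 10; num0 10] [:: 7; 9]].

(* [ProgAux f] maps xs to every k such that f(j, xs) is nonzero for all j < k. *)
Inductive program :=
| ProgFun of recfun
| ProgSeq of seq recfun
| ProgAux of recfun.

(** * Soundness of the evaluation rules *)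

Section Soundness.
Variable M : structure record_sig.
Hypothesis fM : functional M.

(** A model may contain cyclic or infinite chains of records; this predicate and the next two select
    the nodes that represent genuine numbers, lists and programs. *)
Inductive num_at : M -> nat -> Prop :=
| num_at0 x : is_record tag_num0 x x x x -> num_at x 0
| num_atS x y n : is_record tag_numS x y x x -> num_at y n -> num_at x n.+1.

Inductive list_at : M -> seq nat -> Prop :=
| list_at0 l h : is_record tag_list l h l l -> is_record tag_num0 h h h h -> list_at l [::]
| list_atS l h t n s :
    is_record tag_list l h t l -> num_at h n -> list_at t s -> list_at l (n :: s).

Inductive program_at : M -> program -> Prop :=
| at_zero p : is_record tag_zero p p p p -> program_at p (ProgFun RZero)
| at_succ p : is_record tag_succ p p p p -> program_at p (ProgFun RSucc)
| at_proj0 p : is_record tag_proj0 p p p p -> program_at p (ProgFun (RProj 0))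
| at_projS p q i : is_record tag_projS p q p p ->
    program_at q (ProgFun (RProj i)) -> program_at p (ProgFun (RProj i.+1))
| at_comp p q r f gs : is_record tag_comp p q r p ->
    program_at q (ProgFun f) -> program_at r (ProgSeq gs) ->
    program_at p (ProgFun (RComp f gs))
| at_seq0 p : is_record tag_seq0 p p p p -> program_at p (ProgSeq [::])
| at_seqS p q r g gs : is_record tag_seqS p q r p ->
    program_at q (ProgFun g) -> program_at r (ProgSeq gs) ->
    program_at p (ProgSeq (g :: gs))
| at_rec p q r f g : is_record tag_rec p q r p ->
    program_at q (ProgFun f) -> program_at r (ProgFun g) ->
    program_at p (ProgFun (RRec f g))
| at_aux p q f : is_record tag_aux p q p p ->
    program_at q (ProgFun f) -> program_at p (ProgAux f)
| at_min p q f : is_record tag_min p q p p ->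
    program_at q (ProgAux f) -> program_at p (ProgFun (RMin f)).

(** Asserts also that the output node represents a value: the rules do not require this of
    intermediate results, so it has to come out of the induction. *)
Definition evaluates (P : program) (s : seq nat) (y : M) : Prop :=
  match P with
  | ProgFun c => exists2 m, num_at y m & reval c s m
  | ProgSeq gs => exists2 ys, list_at y ys & revals s gs ys
  | ProgAux f => exists2 k, num_at y k & forall j, j < k -> exists z, reval f (j :: s) z.+1
  end.

Lemma num_at0_inv x n a b c : is_record tag_num0 x a b c -> num_at x n -> n = 0.
Proof. by move=> x0 xn; case: xn x0 => // {}x y m xS _ x0; case: (fM xS x0). Qed.

Lemma num_atS_inv x y n b c :
  is_record tag_numS x y b c -> num_at x n -> exists2 m, n = m.+1 & num_at y m.
Proof.
move=> xS xn; case: xn xS => {n}[{}x x0|{}x z n xS zn] xS'; first by case: (fM x0 xS').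
by exists n => //; case: (fM xS xS') => _ <-.
Qed.

(** The empty list needs no separate case: being its own tail with head 0, it behaves like [head 0]
    and [behead]. *)
Lemma list_at_inv l h t c s :
  is_record tag_list l h t c -> list_at l s -> num_at h (head 0 s) /\ list_at t (behead s).
Proof.
move=> lP ls; case: ls lP => {s}[{}l g lP g0|{}l g u n s lP gn us] lP'.
  have [_ <- <- _] := fM lP lP'.
  by split; [apply: num_at0 | apply: list_at0 lP g0].
by have [_ <- <- _] := fM lP lP'.
Qed.

Lemma program_at_inv t p q r c P : is_record t p q r c -> program_at p P ->
  match val t with
  | 0 => P = ProgFun RZero
  | 1 => P = ProgFun RSucc
  | 2 => P = ProgFun (RProj 0)
  | 3 => exists2 i, P = ProgFun (RProj i.+1) & program_at q (ProgFun (RProj i))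
  | 4 => exists f gs, [/\ P = ProgFun (RComp f gs), program_at q (ProgFun f)
                         & program_at r (ProgSeq gs)]
  | 5 => P = ProgSeq [::]
  | 6 => exists g gs, [/\ P = ProgSeq (g :: gs), program_at q (ProgFun g)
                         & program_at r (ProgSeq gs)]
  | 7 => exists f g, [/\ P = ProgFun (RRec f g), program_at q (ProgFun f)
                        & program_at r (ProgFun g)]
  | 8 => exists2 f, P = ProgAux f & program_at q (ProgFun f)
  | 9 => exists2 f, P = ProgFun (RMin f) & program_at q (ProgAux f)
  | _ => False
  end.
Proof.
move=> tP pP; case: pP tP => {p P} p.
- by move=> pP /(fM pP)[<-].
- by move=> pP /(fM pP)[<-].
- by move=> pP /(fM pP)[<-].
- by move=> q' i pP qP /(fM pP)[<- <- _ _]; exists i.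
- by move=> q' r' f gs pP qP rP /(fM pP)[<- <- <- _]; exists f, gs.
- by move=> pP /(fM pP)[<-].
- by move=> q' r' g gs pP qP rP /(fM pP)[<- <- <- _]; exists g, gs.
- by move=> q' r' f g pP qP rP /(fM pP)[<- <- <- _]; exists f, g.
- by move=> q' f pP qP /(fM pP)[<- <- _ _]; exists f.
- by move=> q' f pP qP /(fM pP)[<- <- _ _]; exists f.
Qed.

(** Induction on the derivation. Uniqueness of records identifies the fields in the rule with the
    given ones and excludes true nodes; each rule then reads back as a clause of the semantics. *)
Lemma derivable_sound w : derivable eval_rules w -> forall p l y P s,
  is_record tag_eval w p l y -> program_at p P -> list_at l s -> evaluates P s y.
Proof.
elim=> [{}w tw|k v lt_k r _ + _ IH] p l y P s wE pP ls; first by case: (fM tw wE).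
have {}IH x Q t : x \in rule_premises r -> forall q m z,
    is_record tag_eval (v x) q m z -> program_at q Q -> list_at m t -> evaluates Q t z.
  by move=> xr q m z; apply: IH.
rewrite {}/r in IH *; move: lt_k IH.
do 12?[case: k => [|k]] => //= _ IH [/(fM wE)[_ Ep El Ey]]; subst p l y;
  case=> /program_at_inv /(_ pP) /=.
- by move=> -> [y0 _]; exists 0; first exact: num_at0.
- move=> -> [/list_at_inv /(_ ls)[hP _] [yS _]].
  by exists (head 0 s).+1 => //; apply: num_atS yS hP.
- move=> -> [/list_at_inv /(_ ls)[hP _] _].
  by exists (head 0 s) => //=; rewrite nth0.
- case=> i -> qP [/list_at_inv /(_ ls)[_ tP] [qE _]].
  have [m ym /= Em] := IH 8 _ _ isT _ _ _ qE qP tP.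
  by exists m => //=; rewrite Em nth_behead.
- case=> f [gs [-> fP gsP]] [gsE [fE _]].
  have [zs zP gsz] := IH 7 _ _ isT _ _ _ gsE gsP ls.
  have [m ym fm] := IH 9 _ _ isT _ _ _ fE fP zP.
  by exists m => //; exists zs.
- by move=> -> [n0 [yP _]]; exists [::] => //; apply: list_at0 yP n0.
- case=> g [gs [-> gP gsP]] [gE [gsE [yP _]]].
  have [m zm gm] := IH 7 _ _ isT _ _ _ gE gP ls.
  have [ys zP gsy] := IH 9 _ _ isT _ _ _ gsE gsP ls.
  by exists (m :: ys) => //; apply: list_atS yP zm zP.
- case=> f [g [-> fP gP]] [/list_at_inv /(_ ls)[hP tP] [h0 [fE _]]].
  have [m ym fm] := IH 9 _ _ isT _ _ _ fE fP tP.
  exists m => //; exists (fun=> m); rewrite (num_at0_inv h0 hP); split=> //.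
- case=> f [g [EP fP gP]]; subst P => -[/list_at_inv /(_ ls)[hP tP] [hS]].
  case=> l10 [recE [l13 [l14 [gE _]]]].
  have [n Eh nP] := num_atS_inv hS hP.
  have [z zP [h [h0 hS' Ez]]] := IH 11 _ _ isT _ _ _ recE pP (list_atS l10 nP tP).
  have lP := list_atS l14 nP (list_atS l13 zP tP).
  have [m ym gm] := IH 15 _ _ isT _ _ _ gE gP lP.
  (* The history of the recursive call, known up to [n], is extended by the new value at [n.+1]. *)
  exists m => //; exists (fun k => if k <= n then h k else m).
  rewrite Eh ltnn; split=> // k lt_k; rewrite -ltnS lt_k.
  case: ltnP => [lt_kn|le_nk]; first exact: hS'.
  by have -> : k = n by [apply/eqP; rewrite eqn_leq le_nk -ltnS lt_k]; rewrite -Ez.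
- by case=> f -> fP [y0 _]; exists 0 => //; apply: num_at0.
- case=> f EP fP; subst P => -[auxE [lP [fE [zS [yS _]]]]].
  have [n nP nf] := IH 6 _ _ isT _ _ _ auxE pP ls.
  have [z zP fz] := IH 9 _ _ isT _ _ _ fE fP (list_atS lP nP ls).
  have [z' Ez _] := num_atS_inv zS zP.
  exists n.+1 => [|j]; first exact: num_atS yS nP.
  by rewrite ltnS leq_eqVlt => /predU1P[->|/nf //]; exists z'; rewrite -Ez.
- case=> f -> auxP [/program_at_inv /(_ auxP) [_ [<-] fP]] [auxE [lP [fE [z0 _]]]].
  have [n nP nf] := IH 7 _ _ isT _ _ _ auxE auxP ls.
  have [z zP fz] := IH 9 _ _ isT _ _ _ fE fP (list_atS lP nP ls).
  by exists n => //; split=> //; rewrite -(num_at0_inv z0 zP).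
Qed.

End Soundness.

(** * The intended structure and completeness *)

Inductive node :=
| NTrue
| NNum of nat
| NList of seq nat
| NProg of program
| NEval of program & seq nat & node.

Definition program_record (P : program) : 'I_15 * node * node * node :=
  let x := NProg P in let fn f := NProg (ProgFun f) in
  match P with
  | ProgFun RZero => (tag_zero, x, x, x)
  | ProgFun RSucc => (tag_succ, x, x, x)
  | ProgFun (RProj 0) => (tag_proj0, x, x, x)
  | ProgFun (RProj i.+1) => (tag_projS, fn (RProj i), x, x)
  | ProgFun (RComp f gs) => (tag_comp, fn f, NProg (ProgSeq gs), x)
  | ProgFun (RRec f g) => (tag_rec, fn f, fn g, x)
  | ProgFun (RMin f) => (tag_min, NProg (ProgAux f), x, x)
  | ProgSeq [::] => (tag_seq0, x, x, x)
  | ProgSeq (g :: gs) => (tag_seqS, fn g, NProg (ProgSeq gs), x)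
  | ProgAux f => (tag_aux, fn f, x, x)
  end.

Definition node_record (x : node) : 'I_15 * node * node * node :=
  match x with
  | NTrue => (tag_true, x, x, x)
  | NNum 0 => (tag_num0, x, x, x)
  | NNum n.+1 => (tag_numS, NNum n, x, x)
  | NList s => (tag_list, NNum (head 0 s), NList (behead s), x)
  | NProg P => program_record P
  | NEval P s y => (tag_eval, NProg P, NList s, y)
  end.

(** Contains a node for every evaluation statement, true or false; correctness shows only in
    derivability. *)
Definition node_structure : structure record_sig :=
  @Structure record_sig node (inhabits NTrue) (fun f _ => match (f : void) with end)
    (fun p xs => node_record (xs (@Ordinal 4 0 isT)) =
       (p, xs (@Ordinal 4 1 isT), xs (@Ordinal 4 2 isT), xs (@Ordinal 4 3 isT))).

Lemma node_recordE p (x a b c : node_structure) :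
  is_record p x a b c = (node_record x = (p, a, b, c)).
Proof. by []. Qed.

Lemma node_functional : functional node_structure.
Proof. by move=> p q x a b c a' b' c'; rewrite !node_recordE => -> [-> -> -> ->]. Qed.

Lemma node_true (x : node_structure) : is_true_node x <-> x = NTrue.
Proof.
rewrite /is_true_node node_recordE; split=> [|-> //].
by case: x => [|[|n]|s|[[| |[|i]|f gs|f g|f]|[|g gs]|f]|P s y].
Qed.

(** Instantiates the rule variables 1, 2, ... by the entries of [s], variable 0 being [NTrue]; the
    side conditions then reduce by computation. *)
Lemma derivable_eval_rule k (s : seq node_structure) :
  k < size eval_rules ->
  let r := nth (Rule [::] [::]) eval_rules k in
  let v := nth NTrue (NTrue :: s) in
  All (pattern_holds (M := node_structure) v) (rule_patterns r) ->
  All (fun x => derivable eval_rules (M := node_structure) (v x)) (rule_premises r) ->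
  derivable eval_rules (M := node_structure) (v 1).
Proof.
move=> lt_k r v pats /AllP prems.
by apply: (@derivable_rule eval_rules node_structure k v lt_k) => //; apply/node_true.
Qed.

Lemma derivable_complete c s m :
  reval c s m -> derivable (M := node_structure) eval_rules (NEval (ProgFun c) s (NNum m)).
Proof.
pose D P s y := derivable (M := node_structure) eval_rules (NEval P s y).
rewrite -/(D (ProgFun c) s (NNum m)).
move: c s m; apply: (@recfun_seq_ind _
  (fun gs => forall s ys, revals s gs ys -> D (ProgSeq gs) s (NList ys))).
- move=> s m /= ->; pose l := NList s; pose p := NProg (ProgFun RZero).
  exact: (@derivable_eval_rule 0 [:: NEval (ProgFun RZero) s (NNum 0); p; l; NNum 0]).
- move=> s m /= ->; pose c := ProgFun RSucc.
  exact: (@derivable_eval_rule 1 [:: NEval c s (NNum (head 0 s).+1); NProg c; NList s;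
    NNum (head 0 s).+1; NNum (head 0 s); NList (behead s)]).
- move=> i s m /= ->; elim: i s => [|i IH] s.
    pose c := ProgFun (RProj 0); rewrite nth0.
    exact: (@derivable_eval_rule 2 [:: NEval c s (NNum (head 0 s)); NProg c; NList s;
      NNum (head 0 s); NList (behead s)]).
  pose c := ProgFun (RProj i.+1); pose d := ProgFun (RProj i).
  have {IH} := IH (behead s); rewrite nth_behead; set y := NNum _ => IH.
  apply: (@derivable_eval_rule 3 [:: NEval c s y; NProg c; NList s; y; NProg d;
    NNum (head 0 s); NList (behead s); NEval d (behead s) y]) => //.
- move=> f gs IHf IHgs s m [ys /IHgs Dgs /IHf Df]; pose c := ProgFun (RComp f gs).
  apply: (@derivable_eval_rule 4 [:: NEval c s (NNum m); NProg c; NList s; NNum m;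
    NProg (ProgFun f); NProg (ProgSeq gs); NEval (ProgSeq gs) s (NList ys); NList ys;
    NEval (ProgFun f) ys (NNum m)]) => //.
- move=> f g IHf IHg s m [h [/IHf D0 hS ->]]; pose c := ProgFun (RRec f g).
  (* The recursion rule calls the same program on [k :: behead t], so the induction ranges over all
     lists with the tail of [s]. *)
  suff H k t : behead t = behead s -> head 0 t = k -> k <= head 0 s -> D c t (NNum (h k)).
    exact: H.
  elim: k t => [|k IHk] t Et ht le_k; rewrite -Et in D0 hS.
    apply: (@derivable_eval_rule 7 [:: NEval c t (NNum (h 0)); NProg c; NList t;
      NNum (h 0); NProg (ProgFun f); NProg (ProgFun g); NNum (head 0 t); NList (behead t);
      NEval (ProgFun f) (behead t) (NNum (h 0))]) => //=.
    by rewrite ht; do !split.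
  have Dk := IHk (k :: behead t) Et erefl (ltnW le_k).
  have {IHg} Dg := IHg _ _ (hS k le_k).
  apply: (@derivable_eval_rule 8 [:: NEval c t (NNum (h k.+1)); NProg c; NList t;
    NNum (h k.+1); NProg (ProgFun f); NProg (ProgFun g); NNum (head 0 t);
    NList (behead t); NNum k; NList (k :: behead t); NEval c (k :: behead t) (NNum (h k));
    NNum (h k); NList (h k :: behead t); NList [:: k, h k & behead t];
    NEval (ProgFun g) [:: k, h k & behead t] (NNum (h k.+1))]) => //=.
  by rewrite ht; do !split.
- move=> f IHf s m [/IHf Df fP]; pose c := ProgFun (RMin f); pose d := ProgAux f.
  (* The auxiliary program climbs to [m] one successor at a time, using the nonzero values below [m]
     given by [fP]. *)
  have Daux k : k <= m -> D d s (NNum k).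
    elim: k => [_|k IHk lt_km].
      exact: (@derivable_eval_rule 9 [:: NEval d s (NNum 0); NProg d; NList s; NNum 0;
        NProg (ProgFun f)]).
    have [z /IHf Dz] := fP k lt_km; have Dk := IHk (ltnW lt_km).
    exact: (@derivable_eval_rule 10 [:: NEval d s (NNum k.+1); NProg d; NList s;
      NNum k.+1; NProg (ProgFun f); NEval d s (NNum k); NNum k; NList (k :: s);
      NEval (ProgFun f) (k :: s) (NNum z.+1); NNum z.+1; NNum z]).
  apply: (@derivable_eval_rule 11 [:: NEval c s (NNum m); NProg c; NList s; NNum m;
    NProg d; NProg (ProgFun f); NEval d s (NNum m); NList (m :: s);
    NEval (ProgFun f) (m :: s) (NNum 0); NNum 0]) => //=.
  by do !split=> //; apply: Daux.
- move=> s [|//] _; pose c := ProgSeq [::].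
  exact: (@derivable_eval_rule 5 [:: NEval c s (NList [::]); NProg c; NList s; NList [::];
    NNum 0]).
- move=> g gs IHg IHgs s [|y ys] // [/IHg Dg /IHgs Dgs]; pose c := ProgSeq (g :: gs).
  apply: (@derivable_eval_rule 6 [:: NEval c s (NList (y :: ys)); NProg c; NList s;
    NList (y :: ys); NProg (ProgFun g); NProg (ProgSeq gs); NEval (ProgFun g) s (NNum y);
    NNum y; NEval (ProgSeq gs) s (NList ys); NList ys]) => //.
Qed.

(** * Descriptions of programs by patterns *)

Definition map_pattern (f : nat -> nat) (q : pattern) : pattern :=
  let: Pattern p x a b c := q in Pattern p (f x) (f a) (f b) (f c).

Lemma map_pattern_holds (M : structure record_sig) (v : nat -> M) f ps :
  All (pattern_holds v) (map (map_pattern f) ps) <->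
  All (pattern_holds (fun x => v (f x))) ps.
Proof. by elim: ps => //= -[p x a b c] s ->. Qed.

(** The first half, for every model, serves soundness; the second, in the intended structure, serves
    completeness. *)
Definition describes (ps : seq pattern) (P : program) : Prop :=
  (forall (M : structure record_sig) (v : nat -> M),
     All (pattern_holds v) ps -> program_at (v 0) P) /\
  (exists2 v : nat -> node_structure, v 0 = NProg P & All (pattern_holds v) ps).

Lemma describes0 p P :
  (forall (M : structure record_sig) (x : M), is_record p x x x x -> program_at x P) ->
  program_record P = (p, NProg P, NProg P, NProg P) ->
  exists ps, describes ps P.
Proof.
move=> atP recP; exists [:: Pattern p 0 0 0 0]; split=> [M v [/atP]//|].
by exists (fun=> NProg P).
Qed.

Lemma describes1 p P Q :
  (forall (M : structure record_sig) (x y : M), is_record p x y x x ->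
     program_at y Q -> program_at x P) ->
  program_record P = (p, NProg Q, NProg P, NProg P) ->
  (exists qs, describes qs Q) -> exists ps, describes ps P.
Proof.
move=> atP recP [qs [qsP [v v0 vqs]]].
exists (Pattern p 0 1 0 0 :: map (map_pattern succn) qs); split=> [M w [wP]|].
  by move=> /map_pattern_holds /qsP; apply: atP.
exists (fun x => if x is y.+1 then v y else NProg P) => //.
by split; [rewrite /pattern_holds v0 | apply/map_pattern_holds].
Qed.

(** The two subdescriptions are kept apart by renaming their variables to the odd and to the
    positive even numbers; variable 0 is the new root. *)
Lemma describes2 p P Q R :
  (forall (M : structure record_sig) (x y z : M), is_record p x y z x ->
     program_at y Q -> program_at z R -> program_at x P) ->
  program_record P = (p, NProg Q, NProg R, NProg P) ->
  (exists qs, describes qs Q) -> (exists rs, describes rs R) ->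
  exists ps, describes ps P.
Proof.
move=> atP recP [qs [qsP [v v0 vqs]]] [rs [rsP [w w0 wrs]]].
exists (Pattern p 0 1 2 0 :: map (map_pattern (fun x => x.*2.+1)) qs ++
  map (map_pattern (fun x => x.*2.+2)) rs); split=> [M u [uP]|].
  move=> /All_cat[/map_pattern_holds /qsP uQ /map_pattern_holds /rsP uR].
  exact: atP uP uQ uR.
pose u x := if x is y.+1 then if odd y then w y./2 else v y./2 else NProg P.
have uv : (fun x => u x.*2.+1) = v.
  by apply: functional_extensionality => x; rewrite /u odd_double doubleK.
have uw : (fun x => u x.*2.+2) = w.
  by apply: functional_extensionality => x; rewrite /u /= odd_double uphalf_double.
exists u => //; split; first by rewrite /pattern_holds /u /= v0 w0.
by apply/All_cat; split; apply/map_pattern_holds; rewrite ?uv ?uw.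
Qed.

Lemma describable c : exists ps, describes ps (ProgFun c).
Proof.
move: c; apply: (@recfun_seq_ind _ (fun gs => exists ps, describes ps (ProgSeq gs))).
- by apply: describes0 => // M x; apply: at_zero.
- by apply: describes0 => // M x; apply: at_succ.
- elim=> [|i]; first by apply: describes0 => // M x; apply: at_proj0.
  by apply: describes1 => // M x y; apply: at_projS.
- move=> f gs; apply: describes2 => // M x y z; exact: at_comp.
- move=> f g; apply: describes2 => // M x y z; exact: at_rec.
- move=> f fP; apply: (@describes1 tag_min _ (ProgAux f)) => // [M x y|].
    exact: at_min.
  by apply: describes1 fP => // M x y; apply: at_aux.
- by apply: describes0 => // M x; apply: at_seq0.
- move=> g gs; apply: describes2 => // M x y z; exact: at_seqS.
Qed.

(** * Diagonalisation *)

Definition var_code (x : nat) : nat := CodeSeq.code [:: 0; x].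

(** Independent of the number of variables of the surrounding formula, so that this number can later
    be chosen from the code itself. *)
Definition pattern_code (q : pattern) : nat :=
  let: Pattern p x a b c := q in
  CodeSeq.code [:: 0; CodeSeq.code [:: 0; CodeSeq.code
    [:: 1; pickle p; var_code x; var_code a; var_code b; var_code c]]].

Definition conj_code (ps : seq pattern) : nat :=
  foldr (fun q y => CodeSeq.code [:: 3; pattern_code q; y])
        (CodeSeq.code [:: 2; CodeSeq.code [:: 1]]) ps.

Lemma pattern_form_code n q : pattern_bounded n q ->
  code_qf2 (pattern_form (@inord n) q) = pattern_code q.
Proof.
case: q => p x a b c /and4P[xn an bn cn].
rewrite /code_qf2 /= enum_ord4 /= !inordK //= !inordK //.
Qed.

Lemma conj_form_code n ps : all (pattern_bounded n) ps ->
  code_qf2 (qconj [seq pattern_form (@inord n) q | q <- ps]) = conj_code ps.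
Proof.
by elim: ps => //= q ps IH /andP[qn /IH <-]; rewrite -(pattern_form_code qn).
Qed.

Lemma goal_formula_code n ps qs w t :
  all (pattern_bounded n) ps -> all (pattern_bounded n) qs -> w <= n -> t <= n ->
  code_existsI (goal_formula n ps qs w t) =
  CodeSeq.code [:: n.+1; CodeSeq.code [:: 3; conj_code ps; CodeSeq.code [:: 3;
    CodeSeq.code [:: 0; CodeSeq.code [:: 1; CodeSeq.code [:: 0; var_code w; var_code t]]];
    conj_code qs]]].
Proof.
move=> psn qsn wn tn; rewrite -(conj_form_code psn) -(conj_form_code qsn).
by rewrite /code_existsI /code_qf2 /= !inordK.
Qed.

Lemma pattern_bounded_leq m n q : m <= n -> pattern_bounded m q -> pattern_bounded n q.
Proof.
move=> le_mn; case: q => p x a b c /and4P[*].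
by apply/and4P; split; apply: leq_trans le_mn.
Qed.

Lemma pattern_bounded_code q : pattern_bounded (pattern_code q).-1 q.
Proof.
case: q => p x a b c /=; set s := [:: 1; _; _; _; _; _].
have lt_s : CodeSeq.code s < pattern_code (Pattern p x a b c).
  exact: ltn_trans (@nth_code_lt [:: 0; _] 1 isT) (@nth_code_lt [:: 0; _] 1 isT).
have H i y : i < 6 -> nth 0 s i = var_code y -> y < pattern_code (Pattern p x a b c).
  move=> lt_i Ey; apply: ltn_trans lt_s; apply: ltn_trans (@nth_code_lt s i lt_i).
  by rewrite Ey; apply: (@nth_code_lt [:: 0; y] 1).
have {}H i y : i < 6 -> nth 0 s i = var_code y -> y <= (pattern_code (Pattern p x a b c)).-1.
  by move=> lt_i /(H _ _ lt_i); case: pattern_code.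
by apply/and4P; split; [apply: (H 2)|apply: (H 3)|apply: (H 4)|apply: (H 5)].
Qed.

(** A variable is smaller than any code containing it. Hence all variables of [ps] lie below
    [conj_code ps], and those from there on are free for the input. *)
Lemma conj_bounded_code ps : all (pattern_bounded (conj_code ps).-1) ps.
Proof.
elim: ps => //= q ps IH; set y := conj_code ps in IH *.
have lt1 := @nth_code_lt [:: 3; pattern_code q; y] 1 isT.
have lt2 := @nth_code_lt [:: 3; pattern_code q; y] 2 isT.
have le_pred m n : m < n -> m.-1 <= n.-1 by lia.
rewrite (pattern_bounded_leq (le_pred _ _ lt1) (pattern_bounded_code q)) /=.
by apply: sub_all IH => r; apply: pattern_bounded_leq; apply: le_pred lt2.
Qed.

Lemma conj_code_gt0 ps : 0 < conj_code ps.
Proof.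
case: ps => [|q ps].
  exact: leq_ltn_trans (leq0n _) (@nth_code_lt [:: 2; CodeSeq.code [:: 1]] 1 isT).
exact: leq_ltn_trans (leq0n _) (@nth_code_lt [:: 3; pattern_code q; conj_code ps] 1 isT).
Qed.

(* The variables below k are left to the description of the program, whose root is
   the variable 0; the variable k + i denotes the number i, for i <= k. *)
Definition input_patterns (k : nat) : seq pattern :=
  let true_node := k + k + 1 in let fact := k + k + 2 in
  let input := k + k + 3 in let nil := k + k + 4 in
  [:: Pattern tag_true true_node true_node true_node true_node,
      Pattern tag_eval fact 0 input (k + 1),
      Pattern tag_list input (k + k) nil input,
      Pattern tag_list nil k nil nil,
      Pattern tag_num0 k k k k
    & [seq Pattern tag_numS (k + i).+1 (k + i) (k + i).+1 (k + i).+1 | i <- iota 0 k]].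

Definition run_formula (k : nat) (ps : seq pattern) : existsI_formula records records :=
  goal_formula (k + k + 4) ps (input_patterns k) (k + k + 2) (k + k + 1).

(** The number [k] stands where the code of the description belongs, so for [k = conj_code ps] the
    code of the goal depends on [k] alone. *)
Definition run_code (k : nat) : nat :=
  CodeSeq.code [:: (k + k + 4).+1; CodeSeq.code [:: 3; k; CodeSeq.code [:: 3;
    CodeSeq.code [:: 0; CodeSeq.code [:: 1; CodeSeq.code
      [:: 0; var_code (k + k + 2); var_code (k + k + 1)]]];
    conj_code (input_patterns k)]]].

Lemma input_patterns_bounded k : 0 < k -> all (pattern_bounded (k + k + 4)) (input_patterns k).
Proof.
move=> k_gt0; apply/and5P; split=> /=; try lia.
apply/andP; split; first by lia.
rewrite -/(all (pattern_bounded _) _) all_map.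
by apply/allP => i; rewrite mem_iota /=; lia.
Qed.

Lemma run_formula_code k ps : conj_code ps = k ->
  code_existsI (run_formula k ps) = run_code k.
Proof.
move=> kE; have k_gt0 : 0 < k by rewrite -kE conj_code_gt0.
have psb : all (pattern_bounded (k + k + 4)) ps.
  apply: sub_all (conj_bounded_code ps) => q; apply: pattern_bounded_leq.
  by rewrite kE; lia.
rewrite goal_formula_code ?input_patterns_bounded ?kE //; lia.
Qed.

Lemma computable_run_code : computable 1 (fun xs => run_code (nth 0 xs 0)).
Proof.
pose g i y (xs : seq nat) := let k := nth 0 xs 0 in
  let j := (k + i).+1 in CodeSeq.code [:: 3; pattern_code (Pattern tag_numS j (k + i) j j); y].
(* The part of the input patterns whose length varies with [k] is a fold; the five fixed patterns
   are put in front of it. *)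
pose chain xs := foldr (fun i y => g i y xs) (CodeSeq.code [:: 2; CodeSeq.code [:: 1]])
  (iota 0 (nth 0 xs 0)).
have chainP : computable 1 chain.
  apply: (@computable_foldr 1 (nth 0 ^~ 0) _ g); rewrite /g /pattern_code /var_code;
  by computable.
pose E q y := CodeSeq.code [:: 3; pattern_code q; y].
apply: (@eq_computable _ (fun xs => let k := nth 0 xs 0 in
  CodeSeq.code [:: (k + k + 4).+1; CodeSeq.code [:: 3; k; CodeSeq.code [:: 3;
    CodeSeq.code [:: 0; CodeSeq.code [:: 1; CodeSeq.code
      [:: 0; var_code (k + k + 2); var_code (k + k + 1)]]];
    foldr E (chain xs) (take 5 (input_patterns k))]]])) => [xs|].
  rewrite /run_code.
  congr (CodeSeq.code [:: _; CodeSeq.code [:: _; _; CodeSeq.code [:: _; _; _]]]).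
  rewrite -[in RHS](cat_take_drop 5 (input_patterns _)) /conj_code foldr_cat.
  congr foldr; rewrite /chain /input_patterns /= drop0.
  by elim: (iota _ _) => //= i s ->.
rewrite /E /= /var_code; computable.
by apply: eq_computable chainP => xs; rewrite take0.
Qed.

Lemma program_run_unsafe c ps : describes ps (ProgFun c) ->
  let k := conj_code ps in
  unsafe (rule_system eval_rules) (run_formula k ps) <-> reval c [:: k] 1.
Proof.
move=> [psP [v v0 vps]] k; have k_gt0 : 0 < k by apply: conj_code_gt0.
have psb := conj_bounded_code ps; rewrite -/k in psb.
split=> [/unsafe_goal_sound|ck].
  case=> [M u [tu _]//|M [u [fM ups uin du]]].
  case: uin => _ [fact [input [nil [zero /All_map /AllP succ]]]].
  have numP i : i <= k -> num_at (u (k + i)) i.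
    elim: i => [|i IH] lt_ik; first by rewrite addn0; apply: num_at0.
    have := succ i; rewrite mem_iota addnS => /(_ lt_ik) /num_atS; apply.
    by apply: IH; apply: ltnW.
  have nilP : list_at (u (k + k + 4)) [::] by apply: list_at0 nil zero.
  have inP := list_atS input (numP k (leqnn k)) nilP.
  have [m mP cm] := derivable_sound fM du fact (psP _ _ ups) inP.
  (* As [k] is positive, the output variable [k + 1] lies on the chain of successors and represents
     1. *)
  have uS := succ 0; rewrite mem_iota addn0 in uS; rewrite addn1 in mP.
  have [n Em nP] := num_atS_inv fM (uS k_gt0) mP.
  by move: cm; rewrite Em (num_at0_inv fM zero nP).
pose extra := [:: NTrue; NEval (ProgFun c) [:: k] (NNum 1); NList [:: k]; NList [::]].
(* Three blocks: the description below [k], the numbers 0 to [k], and the four nodes of [extra]. *)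
pose u x : node_structure := if x < k then v x else if x <= k + k then NNum (x - k)
  else nth NTrue extra (x - (k + k + 1)).
have uE j : j < 4 -> u (k + k + j.+1) = nth NTrue extra j.
  move=> lt_j; rewrite /u !ifF; [|lia|lia]; congr nth; lia.
have uN i : i <= k -> u (k + i) = NNum i.
  by move=> le_ik; rewrite /u ifF ?ifT; [rewrite addKn|lia|lia].
have u0 : u 0 = NProg (ProgFun c) by rewrite /u k_gt0.
apply: (@unsafe_goal_complete eval_rules node_structure NTrue _ _ _ _ _ u) => //.
- exact: node_functional.
- exact: node_true.
- by apply: sub_all psb => q; apply: pattern_bounded_leq; lia.
- exact: input_patterns_bounded.
- lia.
- lia.
- elim: (ps) psb vps => //= -[p x a b d] s IH /andP[/and4P[? ? ? ?] sb] [xP sP].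
  split; last exact: IH.
  by rewrite /pattern_holds /u !ifT //; lia.
- have uk : u k = NNum 0 by rewrite -[k in u k]addn0 uN.
  rewrite /input_patterns; do !split; rewrite /pattern_holds ?uE ?uN ?uk ?u0 //.
  apply/All_map/AllP => i; rewrite mem_iota => lt_ik.
  by rewrite -addnS !uN // ltnW.
- by rewrite uE.
- by rewrite uE //; apply: derivable_complete.
Qed.

Theorem theorem4p1 :
  exists TI TE : theory,
    [/\ locally_finite TI, closed_under_substructures TI, locally_finite TE,
        qf_sat_decidable TI & qf_sat_decidable TE] /\
    exists S : array_system TI TE,
      ~ rec_decidable (@code_existsI TI TE) (@safe TI TE S).
Proof.
exists records, records; split.
  have lf := records_locally_finite; have dec := records_sat_decidable.
  by split=> //; apply: records_closed_under_substructures.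
exists (rule_system eval_rules) => -[c0 c0P].
have [d dP] := computableP1 computable_run_code.
(* The diagonal program: it turns its input [k] into the code of the goal formula for [k] and asks
   the supposed decider. *)
have [ps psP] := describable (RComp c0 [:: d]).
have := program_run_unsafe psP; set k := conj_code ps => /= unsafeE.
pose U := run_formula k ps; have UE : code_existsI U = run_code k by apply: run_formula_code.
have [safeU unsafeU] := c0P U; rewrite UE in safeU unsafeU.
(* On a safe goal the decider answers 1; the diagonal program then outputs 1 on its own code, which
   is unsafety. *)
have not_safe : ~ safe (rule_system eval_rules) U.
  move=> sU; apply: (sU); apply/unsafeE; exists [:: run_code k]; last exact: safeU.
  by split=> //; apply: dP.
(* Unsafety would in turn make the decider answer 1, while it answers 0 on a goal that is not safe;
   so the goal is safe after all. *)
apply: (not_safe) => /unsafeE[[|y [|y' ys]] dy cy]; [by []| |by case: dy].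
case: dy => dy _.
have := unsafeU not_safe; rewrite -(reval_inj dy (dP k)) => c0y.
by have := reval_inj cy c0y.
Qed.
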